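(* Let $k$ be a field of characteristic $2$, let $P=\alpha_3u^3+\alpha_2u^2+\alpha_1u+\alpha_0\in k[u]$ be a glueing polynomial with $\alpha_0\neq 0$, and let $Y$ be the surface over $k$ defined in the context. Let $\tau\subset\Omega^1_{Y/k}$ be the torsion subsheaf. Then the coherent $\mathcal{O}_Y$-module $\Omega^1_{Y/k}/\tau$ is locally free of rank two.
   Context: The surface $Y$. Let $X=\mathbb{P}^2_k$ with affine charts $U=\operatorname{Spec}k[u,v]$, $U'=\operatorname{Spec}k[u^{-1},vu^{-1}]$, $U''=\operatorname{Spec}k[uv^{-1},v^{-1}]$. Let $A\subset X$ be the line given by $v=0$ on $U$ and by $vu^{-1}=0$ on $U'$, and let $B\subset X$ be its first order infinitesimal neighborhood (defined by the square of the ideal of $A$), so $B=\operatorname{Spec}k[u,\epsilon]\cup\operatorname{Spec}k[u^{-1},\epsilon u^{-1}]$ where $\epsilon$ is the class of $v$ and $\epsilon^2=0$. Let $C=\operatorname{Spec}k[u^2,u^3]\cup\operatorname{Spec}k[u^{-1}]$ be the rational cuspidal curve of arithmetic genus $1$. Let $\varphi:B\to C$ be the flat morphism of degree two given by $u^2\mapsto u^2$, $u^3\mapsto u^3+\epsilon P$, $u^{-1}\mapsto u^{-1}+\epsilon u^{-4}P$. Then $Y$ is the pushout of the closed embedding $B\subset X$ and $\varphi:B\to C$: it has the same underlying space as $X$, and $\mathcal{O}_Y\subset\mathcal{O}_X$ is the subsheaf of sections whose restriction to $B$ lies in $\mathcal{O}_C$ (embedded in $\mathcal{O}_B$ via $\varphi$).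 It is an integral projective surface, covered by the affine open subschemes $V=\operatorname{Spec}k[u^2,u^3+vP,v^2,v^2u,v^3,v^3u]$, $V'=\operatorname{Spec}k[u^{-2},u^{-1}+vu^{-4}P,v^2u^{-2},v^2u^{-3},v^3u^{-3},v^3u^{-4}]$ and $V''=\operatorname{Spec}k[uv^{-1},v^{-1}]$. *)

(* Defs.v *)
From HB Require Import structures.
From mathcomp Require Import all_boot all_order all_algebra.
From mathcomp Require Import generic_quotient ring_quotient fraction qpoly.
From mathcomp Require Import boolp.
From mathcomp Require Import freeg.

Set Implicit Arguments.
Unset Strict Implicit.
Unset Printing Implicit Defensive.

Import GRing.Theory.
Local Open Scope ring_scope.
Local Open Scope quotient_scope.

Record submodule (R : nzRingType) (M : lmodType R) := Submodule {
  submod_pred :> {pred M};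
  submod_predP : submod_closed submod_pred }.

Section Quotients.
Variables (R : nzRingType) (M : lmodType R) (N : submodule M).

Fact submod_zmodP : zmod_closed (submod_pred N).
Proof.
have [N0 NZ] := submod_predP N; split=> // x y Nx Ny.
by rewrite addrC -scaleN1r; apply: NZ.
Qed.

HB.instance Definition _ :=
  GRing.isZmodClosed.Build M (submod_pred N) submod_zmodP.

Definition mquot := Quotient.quot (submod_pred N).
HB.instance Definition _ := GRing.Zmodule.on mquot.
HB.instance Definition _ := Quotient.on mquot.

Definition mproj (m : M) : mquot := \pi_mquot m.

Fact mproj_eq m m' : (mproj m = mproj m') <-> (m - m' \in N).
Proof.
by rewrite /mproj (Quotient.idealrBE (submod_pred N)); split=> /eqP.
Qed.

Fact mprojB : {morph mproj : x y / x - y}.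
Proof. by move=> x y; rewrite /mproj /mquot !piE. Qed.

Fact mprojD : {morph mproj : x y / x + y}.
Proof. by move=> x y; rewrite /mproj /mquot !piE. Qed.

Definition mscale (a : R) (q : mquot) : mquot := mproj (a *: repr q).

Fact mscaleE a m : mscale a (mproj m) = mproj (a *: m).
Proof.
apply/mproj_eq; rewrite -scalerBr; have [N0 NZ] := submod_predP N.
rewrite -[_ *: _]addr0; apply: NZ => //; apply/mproj_eq.
by rewrite /mproj reprK.
Qed.

Fact mprojP (q : mquot) : exists m, q = mproj m.
Proof. by exists (repr q); rewrite /mproj reprK. Qed.

Fact mscaleA a b q : mscale a (mscale b q) = mscale (a * b) q.
Proof. by have [m ->] := mprojP q; rewrite !mscaleE scalerA. Qed.
Fact mscale1 : left_id 1 mscale.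
Proof. by move=> q; have [m ->] := mprojP q; rewrite mscaleE scale1r. Qed.
Fact mscaleDr : right_distributive mscale +%R.
Proof.
move=> a q r; have [m ->] := mprojP q; have [n ->] := mprojP r.
by rewrite -mprojD !mscaleE -mprojD scalerDr.
Qed.
Fact mscaleDl q : {morph mscale^~ q : a b / a + b}.
Proof.
by move=> a b; have [m ->] := mprojP q; rewrite !mscaleE -mprojD scalerDl.
Qed.

HB.instance Definition _ :=
  GRing.Zmodule_isLmodule.Build R mquot mscaleA mscale1 mscaleDr mscaleDl.

Fact mproj_linear : linear mproj.
Proof. by move=> a x y; rewrite mprojD -mscaleE. Qed.

HB.instance Definition _ := GRing.isLinear.Build R M mquot _ mproj mproj_linear.

End Quotients.

Section Span.
Variables (R : nzRingType) (M : lmodType R) (S : M -> Prop).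

Definition span_pred : {pred M} := fun m =>
  `[< forall N : submodule M, (forall s, S s -> s \in N) -> m \in N >].

Fact span_closed : submod_closed span_pred.
Proof.
split=> [|a x y /asboolP hx /asboolP hy]; apply/asboolP => N SN.
  by case: (submod_predP N).
by have [_ h] := submod_predP N; apply: h; [apply: hx | apply: hy].
Qed.

Definition span : submodule M := Submodule span_closed.
End Span.

Section Torsion.
Variables (R : comNzRingType) (M : lmodType R).

Definition torsion_pred : {pred M} := fun m =>
  `[< exists r : R, GRing.lreg r /\ r *: m = 0 >].

Fact torsion_closed : submod_closed torsion_pred.
Proof.
split=> [|a x y /asboolP [r [hr rx]] /asboolP [s [hs sy]]]; apply/asboolP.
  by exists 1; split; [exact: lreg1 | rewrite scaler0].
exists (r * s); split; first exact: lregM.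
rewrite scalerDr !scalerA -[r * s * a]mulrA [r * _]mulrC -!scalerA rx.
by rewrite sy !scaler0 addr0.
Qed.

Definition torsion : submodule M := Submodule torsion_closed.
End Torsion.

Section Kaehler.
Variables (k R : comNzRingType) (f : {rmorphism k -> R}).

(* The generator << a >> of the free R-module {freeg R / R} stands for da. *)
Variant kaehler_rel : {freeg R / R} -> Prop :=
| KaehlerD a b : kaehler_rel (<< a + b >> - (<< a >> + << b >>))
| KaehlerM a b : kaehler_rel (<< a * b >> - (a *: << b >> + b *: << a >>))
| KaehlerC c : kaehler_rel << f c >>.

Definition kaehler : lmodType R := mquot (span kaehler_rel).
Definition kaehler_d (a : R) : kaehler := mproj (span kaehler_rel) << a >>.
End Kaehler.

(* The projective plane X is modelled as an integral scheme inside its        *)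
(* function field k(u, v): a point is given by its local ring, a subring of   *)
(* k(u, v), so that points of different charts are identified exactly when    *)
(* their local rings agree (X is separated).                                  *)

Section FunctionField.
Variable k : fieldType.

(* k(u, v); the inner variable is u, the outer one is v. *)
Definition K : fieldType := {fraction {poly {poly k}}}.

Definition cst : k -> K := @tofrac {poly {poly k}} \o polyC \o polyC.
HB.instance Definition _ := GRing.RMorphism.on cst.

Definition u : K := tofrac ('X%:P : {poly {poly k}}).
Definition v : K := tofrac ('X : {poly {poly k}}).
Definition evalu (p : {poly k}) : K := tofrac p%:P.

(* The k-subalgebra of k(u, v) generated by a finite sequence. *)
Inductive in_alg (s : seq K) : K -> Prop :=
| AlgC c : in_alg s (cst c)
| AlgG x : x \in s -> in_alg s x
| AlgD x y : in_alg s x -> in_alg s y -> in_alg s (x + y)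
| AlgM x y : in_alg s x -> in_alg s y -> in_alg s (x * y).

Definition alg (s : seq K) : {pred K} := fun x => `[< in_alg s x >].

Record prime_ideal (R p : {pred K}) : Prop := PrimeIdeal {
  prime_sub : {subset p <= R};
  prime_0 : 0 \in p;
  prime_1 : 1 \notin p;
  prime_lin : forall a x y, a \in R -> x \in p -> y \in p -> a * x + y \in p;
  prime_mul : forall a b, a \in R -> b \in R -> a * b \in p ->
    (a \in p) || (b \in p) }.

(* Fractions with numerator in R and denominator in R but not in p. *)
Definition loc (R p : {pred K}) : {pred K} := fun x =>
  `[< exists a b, [/\ a \in R, b \in R, b \notin p & x = a / b] >].

Variant chart := chU | chU' | chU''.

Definition OX_chart (c : chart) : {pred K} :=
  match c with
  | chU => alg [:: u; v]
  | chU' => alg [:: u^-1; v * u^-1]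
  | chU'' => alg [:: u * v^-1; v^-1]
  end.

Record point := Point {
  OX : {pred K};
  pointP : exists c p, prime_ideal (OX_chart c) p /\ OX =i loc (OX_chart c) p }.

Definition at_prime (x : point) (c : chart) (p : {pred K}) : Prop :=
  prime_ideal (OX_chart c) p /\ OX x =i loc (OX_chart c) p.

Definition openX (W : point -> Prop) : Prop :=
  forall x c p, W x -> at_prime x c p ->
  exists f, [/\ f \in OX_chart c, f \notin p &
    forall y q, at_prime y c q -> f \notin q -> W y].

(* The local equation of the line A, which does not meet U''. *)
Definition eqA (c : chart) : K :=
  match c with chU => v | chU' => v * u^-1 | chU'' => 1 end.

End FunctionField.

Arguments u {k}.
Arguments v {k}.
Arguments eqA {k} c.

Section Surface.
Variables (k : fieldType) (P : {poly_4 k}).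
Local Notation K := (K k).
Local Notation Pu := (evalu (P : {poly k})).

(* P = sum_(i < 4) P`_i u^i. The reduction of OC_chart c modulo (eqA c)^2 is  *)
(* the image under phi of the coordinate ring of C in that of B: on U, u^2    *)
(* and u^3 are sent to the classes of u^2 and u^3 + v P, and on U', u^-1 is   *)
(* sent to the class of u^-1 + v u^-4 P. The chart U'' does not meet B.       *)
Definition OC_chart (c : chart) : {pred K} :=
  match c with
  | chU => alg [:: u ^+ 2; u ^+ 3 + v * Pu]
  | chU' => alg [:: u^-1 + v * u^- 4 * Pu]
  | chU'' => alg [::]
  end.

(* Y has the same points and topology as X, and its local ring at x consists  *)
(* of the germs f of O_X at x such that, if x lies on A, the class of f in    *)
(* O_B = O_X / (eqA c)^2 comes from the local ring of C. If x lies in both U  *)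
(* and U', the two conditions agree because phi is well defined.              *)
Definition OY_pred (x : point k) : {pred K} := fun f =>
  (f \in OX x) &&
  `[< forall c p, at_prime x c p -> eqA c \in p ->
      exists g t, [/\ g \in loc (OC_chart c) p, t \in OX x &
                      f = g + eqA c ^+ 2 * t] >].

Fact alg_subring (s : seq K) : subring_closed (alg s).
Proof.
have aM x y : x \in alg s -> y \in alg s -> x * y \in alg s.
  by move=> /asboolP ax /asboolP ay; apply/asboolP/AlgM.
have aC c : cst c \in alg s by apply/asboolP/AlgC.
split=> // [|x y /asboolP ax ay]; first by rewrite -(rmorph1 (@cst k)) aC.
apply/asboolP/AlgD => //; apply/asboolP.
have -> : - y = cst (-1) * y by rewrite rmorphN1 mulN1r.
exact: aM.
Qed.

HB.instance Definition _ (s : seq K) :=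
  GRing.isSubringClosed.Build K (alg s) (alg_subring s).

Fact alg_cst (s : seq K) c : cst c \in alg s.
Proof. exact/asboolP/AlgC. Qed.

Fact alg_gen (s : seq K) x : x \in s -> x \in alg s.
Proof. by move=> xs; apply/asboolP/AlgG. Qed.

Fact sub_alg (s s' : seq K) : {subset s <= alg s'} -> {subset alg s <= alg s'}.
Proof.
move=> ss x /asboolP; elim=> {x} [c|x /ss|x y _ hx _ hy|x y _ hx _ hy] //.
- exact: alg_cst.
- exact: rpredD.
- exact: rpredM.
Qed.

Fact OX_chart_subring c : subring_closed (@OX_chart k c).
Proof. by case: c; apply: alg_subring. Qed.

Fact OC_chart_subring c : subring_closed (OC_chart c).
Proof. by case: c; apply: alg_subring. Qed.

Fact eqA_OX_chart c : @eqA k c \in OX_chart c.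
Proof. by case: c; rewrite ?rpred1 // alg_gen // !inE eqxx orbT. Qed.

Fact PuE : Pu = \sum_(i < 4) cst (P : {poly k})`_i * u ^+ i.
Proof.
have PE : (P : {poly k}) = \poly_(i < 4) P`_i.
  apply/polyP => i; rewrite coef_poly; case: ltnP => // iP.
  by rewrite nth_default // (leq_trans (size_npoly P)).
rewrite /evalu {1}PE poly_def !raddf_sum; apply: eq_bigr => i _ /=.
by rewrite -mul_polyC !rmorphM !rmorphXn.
Qed.

Fact OC_chartW c : {subset OC_chart c <= OX_chart c}.
Proof.
have u0 : (u : K) != 0 by rewrite /u tofrac_eq0 polyC_eq0 polyX_eq0.
case: c; rewrite /OC_chart /OX_chart; apply: sub_alg => // x; rewrite !inE;
  [case/orP|] => /eqP ->.
- by apply/rpredX/alg_gen; rewrite inE eqxx.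
- apply: rpredD; first by apply/rpredX/alg_gen; rewrite inE eqxx.
  rewrite PuE; apply: rpredM; first by apply: alg_gen; rewrite !inE eqxx orbT.
  apply: rpred_sum => i _; apply: rpredM; first exact: alg_cst.
  by apply/rpredX/alg_gen; rewrite inE eqxx.
apply: rpredD; first by apply: alg_gen; rewrite inE eqxx.
rewrite PuE mulr_sumr; apply: rpred_sum => i _.
have -> : v * u^- 4 * (cst P`_i * u ^+ i) =
          (v * u^-1) * (cst P`_i * u^-1 ^+ (3 - i)) :> K.
  have i3 : (i <= 3)%N by rewrite -ltnS ltn_ord.
  rewrite -!mulrA; congr (_ * _); rewrite mulrCA [RHS]mulrCA; congr (_ * _).
  rewrite -exprS -subSn // -exprVn.
  have -> : u^-1 ^+ 4 = u^-1 ^+ (4 - i) * u^-1 ^+ i :> K.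
    by rewrite -exprD subnK // leqW.
  by rewrite -mulrA -exprMn mulVf // expr1n mulr1.
apply: rpredM; first by apply: alg_gen; rewrite !inE eqxx orbT.
apply: rpredM; first exact: alg_cst.
by apply/rpredX/alg_gen; rewrite inE eqxx.
Qed.

Fact loc_subring (R S p : {pred K}) : prime_ideal R p ->
  subring_closed S -> {subset S <= R} -> subring_closed (loc S p).
Proof.
move=> pp [S1 SB SM] SR; have p1 := prime_1 pp.
have pM b d : b \in S -> d \in S -> b \notin p -> d \notin p -> b * d \notin p.
  move=> bS dS bp dp; apply/negP => /(prime_mul pp (SR _ bS) (SR _ dS)).
  by rewrite (negbTE bp) (negbTE dp).
have n0 b : b \notin p -> b != 0.
  by apply: contraNneq => ->; apply: prime_0 pp.
split.
- by apply/asboolP; exists 1, 1; rewrite divr1; split.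
- move=> x y /asboolP [a [b [aS bS bp ->]]] /asboolP [c [d [cS dS dp ->]]].
  apply/asboolP; exists (a * d - c * b), (b * d); split.
  + by apply: SB; apply: SM.
  + exact: SM.
  + exact: pM.
  + by rewrite -mulNr addf_div ?n0 // mulNr.
- move=> x y /asboolP [a [b [aS bS bp ->]]] /asboolP [c [d [cS dS dp ->]]].
  apply/asboolP; exists (a * c), (b * d); split; rewrite ?mulf_div //.
  + exact: SM.
  + exact: SM.
  + exact: pM.
Qed.

Fact sub_loc (S p : {pred K}) : subring_closed S -> 1 \notin p ->
  {subset S <= loc S p}.
Proof.
move=> [S1 _ _] p1 a aS; apply/asboolP; exists a, 1.
by rewrite divr1; split.
Qed.

Section Stalk.
Variable x : point k.

Fact OX_subring : subring_closed (OX x).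
Proof.
have [ch [p [pp E]]] := pointP x.
have [l1 lB lM] := loc_subring pp (OX_chart_subring ch) (fun _ => id).
by split=> [|a b|a b]; rewrite !E //; [apply: lB | apply: lM].
Qed.

HB.instance Definition _ :=
  GRing.isSubringClosed.Build K (OX x) OX_subring.

Fact OX_at c p : at_prime x c p -> {subset @OX_chart k c <= OX x}.
Proof.
move=> [pp E] a ha; rewrite E.
exact: (sub_loc (OX_chart_subring c) (prime_1 pp)).
Qed.

Fact OY_subring : subring_closed (OY_pred x).
Proof.
have locP c p : at_prime x c p -> subring_closed (loc (OC_chart c) p).
  by move=> [pp _]; apply: loc_subring pp (OC_chart_subring c) (@OC_chartW c).
split.
- apply/andP; split; first exact: rpred1.
  apply/asboolP => c p xp Ap; exists 1, 0; split; rewrite ?mulr0 ?addr0 //.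
    by have [] := locP _ _ xp.
  exact: rpred0.
- move=> f f' /andP [fX /asboolP fY] /andP [fX' /asboolP fY'].
  apply/andP; split; first exact: rpredB.
  apply/asboolP => c p xp Ap; have [_ lB _] := locP _ _ xp.
  have [g [t [gl tX ->]]] := fY _ _ xp Ap.
  have [g' [t' [gl' tX' ->]]] := fY' _ _ xp Ap.
  exists (g - g'), (t - t'); split; [exact: lB | exact: rpredB |].
  by rewrite opprD mulrBr addrACA.
- move=> f f' /andP [fX /asboolP fY] /andP [fX' /asboolP fY'].
  apply/andP; split; first exact: rpredM.
  apply/asboolP => c p xp Ap; have [_ _ lM] := locP _ _ xp.
  have [g [t [gl tX fE]]] := fY _ _ xp Ap.
  have [g' [t' [gl' tX' fE']]] := fY' _ _ xp Ap.
  have eX : eqA c \in OX x by apply: (OX_at xp); apply: eqA_OX_chart.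
  have gX' : g' \in OX x.
    have -> : g' = f' - eqA c ^+ 2 * t' by rewrite fE' addrK.
    by rewrite rpredB // rpredM // rpredX.
  exists (g * g'), (f * t' + t * g'); split; first exact: lM.
    by rewrite rpredD // rpredM.
  by rewrite mulrDr mulrCA [_ * (t * g')]mulrA addrCA -mulrDl addrC -fE
             -mulrDr -fE'.
Qed.

HB.instance Definition _ :=
  GRing.isSubringClosed.Build K (OY_pred x) OY_subring.

Fact cst_OY c : cst c \in OY_pred x.
Proof.
apply/andP; split.
  have [ch [p [pp E]]] := pointP x.
  by apply: (@OX_at ch p); rewrite ?/at_prime //; case: ch {pp E};
    apply: alg_cst.
apply/asboolP => ch p [pp E] Ap; exists (cst c), 0; split.
- apply: (sub_loc (OC_chart_subring ch) (prime_1 pp)).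
  by case: ch {pp E Ap}; apply: alg_cst.
- exact: rpred0.
- by rewrite mulr0 addr0.
Qed.

Record OY := MkOY { OYval :> K; OYvalP : OYval \in OY_pred x }.

HB.instance Definition _ := [isSub for OYval].
HB.instance Definition _ := [Choice of OY by <:].
HB.instance Definition _ := [SubChoice_isSubComNzRing of OY by <:].

Definition OY_cst (c : k) : OY := MkOY (cst_OY c).

Fact OY_cst_zmod : zmod_morphism OY_cst.
Proof. by move=> a b; apply: val_inj; rewrite /= rmorphB. Qed.
Fact OY_cst_monoid : monoid_morphism OY_cst.
Proof.
by split=> [|a b]; apply: val_inj; rewrite /= ?rmorph1 ?rmorphM.
Qed.

HB.instance Definition _ := GRing.isZmodMorphism.Build k OY OY_cst OY_cst_zmod.
HB.instance Definition _ :=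
  GRing.isMonoidMorphism.Build k OY OY_cst OY_cst_monoid.

(* Meaningful only when f \in OY_pred x, the value being 0 otherwise. *)
Definition germ (f : K) : OY := insubd 0 f.

(* The stalks at x of the sheaf Omega^1_{Y/k} and of its quotient by its      *)
(* torsion subsheaf. *)
Definition OmegaY : lmodType OY := kaehler OY_cst.
Definition OmegaY_mod_tors : lmodType OY := mquot (torsion OmegaY).

End Stalk.

(* Y is integral: for W open and nonempty, O_Y(W) is the intersection of the  *)
(* local rings at the points of W. *)
Definition sectionO (W : point k -> Prop) (f : K) : Prop :=
  forall x, W x -> f \in OY_pred x.

Definition open_nbhd (W W' : point k -> Prop) (x : point k) : Prop :=
  [/\ openX W', W' x & forall y, W' y -> W y].

(* Omega^1_{Y/k} is the sheaf associated with W |-> Omega^1_{O_Y(W)/k}: its   *)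
(* sections are the families of germs which are locally given by a single     *)
(* finite sum of terms a db, with a and b sections of O_Y. *)
Definition sectionOmega (W : point k -> Prop) (s : forall x, OmegaY x) : Prop :=
  forall x, W x -> exists W', open_nbhd W W' x /\
  exists ab : seq (K * K),
    (forall z, z \in ab -> sectionO W' z.1 /\ sectionO W' z.2) /\
    forall y, W' y ->
      s y = \sum_(z <- ab) germ y z.1 *: kaehler_d (@OY_cst y) (germ y z.2).

Definition sectionOmega_mod_tors (W : point k -> Prop)
    (t : forall x, OmegaY_mod_tors x) : Prop :=
  forall x, W x -> exists W', open_nbhd W W' x /\
  exists s, sectionOmega W' s /\
    forall y, W' y -> t y = mproj (torsion (OmegaY y)) (s y).

(* F|_W is free of rank n: O_Y^n(W') -> F(W') is bijective for all nonempty   *)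
(* open W' in W. *)
Definition free_on (n : nat) (F : forall x, lmodType (OY x))
    (sectionF : (point k -> Prop) -> (forall x, F x) -> Prop)
    (W : point k -> Prop) : Prop :=
  exists e : 'I_n -> forall x, F x, (forall i, sectionF W (e i)) /\
  forall W', openX W' -> (forall y, W' y -> W y) -> (exists y, W' y) ->
  forall s, sectionF W' s -> exists! a : {ffun 'I_n -> K},
    (forall i, sectionO W' (a i)) /\
    forall y, W' y -> s y = \sum_(i < n) germ y (a i) *: e i y.

Definition locally_free (n : nat) (F : forall x, lmodType (OY x))
    (sectionF : (point k -> Prop) -> (forall x, F x) -> Prop) : Prop :=
  forall x, exists W, [/\ openX W, W x & free_on n sectionF W].

End Surface.

(* Main.v *)
Require Import Defs.
From HB Require Import structures.
From mathcomp Require Import all_boot all_order all_algebra.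
From mathcomp Require Import qpoly.
From mathcomp Require Import generic_quotient fraction boolp freeg ring.

(** Why the theorem holds. Modulo torsion, the stalk of Omega^1 at a point of Y
    embeds in the two-dimensional space of differentials of k(u, v)
    (kaehler_torsionP). Hence db1, db2 is a basis of the stalk as soon as there
    are derivations D1, D2 of k(u, v) dual to b1, b2 which map the local ring of
    Y into itself: then df = D1 f db1 + D2 f db2 for every f of the local ring.
    If this holds at all points of an open set W, the sheaf is free on W
    (free_on_criterion): Y is irreducible, so the coefficients of a section are
    read off at the generic point.

    Let R = P/u^3, s = 1/u and r = v/u, so that A is r = 0 in U'. The following
    three open sets cover Y.
    - Off A, where Y = X, the coordinates of U'' give a basis.
    - In U', the ring of C is generated modulo r^2 by w = s + rR, so that
      near A the local rings look like k[w] + r^2 k[w, r]. A basis is dw and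
      d(r^3) = r^2 dr, on the open set where w and r are local coordinates.
    - Near the cusp, let z = u^3 + vP. A basis is dz and d(v^2 u) = v^2 du, on
      the open set of U where P is invertible. It contains the cusp because
      alpha_0 is not 0.

    In the last two cases the local rings of Y are cut out in those of X by
    linear differential conditions modulo the equation of A (glued_smooth and
    glued_cusp, justified by OY_in_U' and OY_in_U). In characteristic 2 all
    second derivatives with respect to one variable vanish, and this turns
    divisibility by the equation of A into divisibility by its square. That is
    why D1 and D2 preserve the conditions (glued_smooth_dual and
    glued_cusp_dual). *)

Set Implicit Arguments.
Unset Strict Implicit.
Unset Printing Implicit Defensive.

Import GRing.Theory.
Local Open Scope ring_scope.

(** * Derivations *)

Section SubringClosed.
Variables (F : fieldType) (O : {pred F}).
Hypothesis Osub : subring_closed O.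
#[local] HB.instance Definition _ := GRing.isSubringClosed.Build F O Osub.
Lemma subring_0 : 0 \in O. Proof. exact: rpred0. Qed.
Lemma subring_1 : 1 \in O. Proof. exact: rpred1. Qed.
Lemma subring_D f g : f \in O -> g \in O -> f + g \in O.
Proof. exact: rpredD. Qed.
Lemma subring_N f : f \in O -> - f \in O. Proof. by rewrite rpredN. Qed.
Lemma subring_M f g : f \in O -> g \in O -> f * g \in O.
Proof. exact: rpredM. Qed.
Lemma subring_X f n : f \in O -> f ^+ n \in O. Proof. exact: rpredX. Qed.
End SubringClosed.

Ltac in_subring H tac := repeat first
  [ assumption | tac | apply: (subring_0 H) | apply: (subring_1 H)
  | apply: (subring_X H) | apply: (subring_N H) | apply: (subring_D H)
  | apply: (subring_M H) ].

Record derivation (k F : fieldType) (C : k -> F) (D : F -> F) : Prop :=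
  Derivation {
    derC : forall c, D (C c) = 0;
    derD : forall f g, D (f + g) = D f + D g;
    derM : forall f g, D (f * g) = f * D g + g * D f }.

(** The field coord_gen says that x and y generate F as a field over k. It is
    stated as an induction principle because this is how it is used: two
    derivations over k which agree on x and y are equal, and a property of
    elements of F that is stable under the field operations need only be
    checked on x and y. *)
Record coordinates (k F : fieldType) (C : k -> F) (x y : F) (dx dy : F -> F) :
  Prop := Coordinates {
    dx_der : derivation C dx;
    dy_der : derivation C dy;
    dx_x : dx x = 1; dx_y : dx y = 0; dy_x : dy x = 0; dy_y : dy y = 1;
    coord_gen : forall S : F -> Prop, (forall c, S (C c)) -> S x -> S y ->
      (forall f g, S f -> S g -> S (f + g)) ->
      (forall f g, S f -> S g -> S (f * g)) ->
      (forall f, S f -> S f^-1) -> forall f, S f }.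

Section DerivationTheory.
Variables (k F : fieldType) (C : k -> F) (D : F -> F).
Hypothesis DD : derivation C D.

Lemma der0 : D 0 = 0.
Proof. by apply: (addrI (D 0)); rewrite -(derD DD) !addr0. Qed.
Lemma der1 : D 1 = 0.
Proof. by have := derM DD 1 1; rewrite !mul1r -[LHS]addr0 => /addrI <-. Qed.
Lemma derN f : D (- f) = - D f.
Proof. by apply: (addrI (D f)); rewrite -(derD DD) !subrr der0. Qed.
Lemma derB f g : D (f - g) = D f - D g.
Proof. by rewrite (derD DD) derN. Qed.
Lemma der_div f g : g != 0 -> D (f / g) = (D f * g - f * D g) / g ^+ 2.
Proof.
move=> g0; have := derM DD (f / g) g; rewrite divfK // => ->.
by field.
Qed.
Lemma derV f : D f^-1 = - D f / f ^+ 2.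
Proof.
have [->|f0] := eqVneq f 0; first by rewrite invr0 der0 oppr0 mul0r.
by rewrite -[f^-1]mul1r der_div // der1 mul0r sub0r mul1r.
Qed.
End DerivationTheory.

Section PolynomialValues.
Variables (k F : fieldType) (C : {rmorphism k -> F}).

Definition peval (x : F) (p : {poly k}) : F := (map_poly C p).[x].

Lemma pevalD x p q : peval x (p + q) = peval x p + peval x q.
Proof. by rewrite /peval rmorphD hornerD. Qed.
Lemma pevalB x p q : peval x (p - q) = peval x p - peval x q.
Proof. by rewrite /peval rmorphB hornerD hornerN. Qed.
Lemma pevalM x p q : peval x (p * q) = peval x p * peval x q.
Proof. by rewrite /peval rmorphM hornerM. Qed.
Lemma pevalX x : peval x 'X = x.
Proof. by rewrite /peval map_polyX hornerX. Qed.
Lemma pevalC x c : peval x c%:P = C c.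
Proof. by rewrite /peval map_polyC hornerC. Qed.
Lemma pevalXn x p n : peval x (p ^+ n) = peval x p ^+ n.
Proof. by rewrite /peval rmorphXn horner_exp. Qed.
Lemma peval0 x : peval x 0 = 0.
Proof. by rewrite /peval rmorph0 horner0. Qed.

Lemma peval_in (S : {pred F}) x p : subring_closed S ->
  (forall c, C c \in S) -> x \in S -> peval x p \in S.
Proof.
move=> Ssub SC Sx.
elim/poly_ind: p => [|p c IH]; first by rewrite peval0; apply: subring_0.
rewrite pevalD pevalM pevalX pevalC; apply: (subring_D Ssub) => //.
exact: (subring_M Ssub).
Qed.

Lemma der_peval D x p : derivation C D ->
  D (peval x p) = peval x p^`() * D x.
Proof.
move=> DD; elim/poly_ind: p => [|p c IH].
  by rewrite linear0 peval0 (der0 DD) mul0r.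
rewrite derivMXaddC !(pevalD, pevalM, pevalX, pevalC) (derD DD) (derM DD).
by rewrite (derC DD) IH; ring.
Qed.

Lemma peval_taylor (S : {pred F}) x h p : subring_closed S ->
  (forall c, C c \in S) -> x \in S -> h \in S ->
  exists2 q, q \in S & peval (x + h) p =
    peval x p + h * peval x p^`() + h ^+ 2 * q.
Proof.
move=> Ssub SC Sx Sh.
elim/poly_ind: p => [|p c [q Sq IH]].
  exists 0; first exact: subring_0.
  by rewrite linear0 !peval0 !mulr0 !addr0.
exists (q * (x + h) + peval x p^`()).
  by in_subring Ssub ltac:(apply: peval_in).
by rewrite derivMXaddC !(pevalD, pevalM, pevalX, pevalC) IH; ring.
Qed.
End PolynomialValues.

(** * Partial derivatives of the function field *)

Lemma quot_rule_add (F : fieldType) (a b a' b' da db da' db' : F) :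
  b != 0 -> b' != 0 ->
  ((a * db' + b' * da + (a' * db + b * da')) * (b * b')
    - (a * b' + a' * b) * (b * db' + b' * db)) / (b * b') ^+ 2 =
  (da * b - a * db) / b ^+ 2 + (da' * b' - a' * db') / b' ^+ 2.
Proof. by move=> b0 b'0; field; rewrite b0 b'0. Qed.

Lemma quot_rule_mul (F : fieldType) (a b a' b' da db da' db' : F) :
  b != 0 -> b' != 0 ->
  ((a * da' + a' * da) * (b * b') - a * a' * (b * db' + b' * db))
    / (b * b') ^+ 2 =
  a / b * ((da' * b' - a' * db') / b' ^+ 2)
    + a' / b' * ((da * b - a * db) / b ^+ 2).
Proof. by move=> b0 b'0; field; rewrite b0 b'0. Qed.

Section FractionField.
Variables (R : idomainType) (d : R -> R).
Hypothesis dD : forall a b, d (a + b) = d a + d b.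
Hypothesis dM : forall a b, d (a * b) = a * d b + b * d a.
Local Notation F := {fraction R}.
Local Notation frac := (@tofrac R).

Lemma fraction_quot (f : F) : exists a b, b != 0 /\ f = frac a / frac b.
Proof.
elim/quotW: f => x; exists \n_x, \d_x; split; first exact: denom_ratioP.
have b0 : frac \d_x != 0 by rewrite tofrac_eq0 denom_ratioP.
apply: (mulIf b0); rewrite divfK //.
rewrite /tofrac; unlock FracField.tofrac.
have -> : forall a b : F, a * b = FracField.mul a b by [].
rewrite !piE; apply/eqmodP => /=.
rewrite equivfE.
rewrite /FracField.mulf !numden_Ratio ?mulf_neq0 ?oner_neq0 ?denom_ratioP //.
by rewrite !mulr1 mulrC.
Qed.

(** The extension of d to the fraction field. It is computed on a chosen
    representative of the fraction; quot_ruleE shows that all representatives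
    give the same value. *)
Definition quot_rule (f : F) : F :=
  let a := sval (cid (fraction_quot f)) in
  let b := sval (cid (svalP (cid (fraction_quot f)))) in
  (frac (d a) * frac b - frac a * frac (d b)) / frac b ^+ 2.

Lemma quot_ruleE a b : b != 0 ->
  quot_rule (frac a / frac b) =
  (frac (d a) * frac b - frac a * frac (d b)) / frac b ^+ 2.
Proof.
move=> b0; rewrite /quot_rule; case: cid => a1 h1 /=.
case: cid => b1 /= [b10 e].
have B0 : frac b != 0 by rewrite tofrac_eq0.
have B10 : frac b1 != 0 by rewrite tofrac_eq0.
have e1 : frac a * frac b1 = frac a1 * frac b.
  by apply/eqP; rewrite -eqr_div // e.
have e2 : a * b1 = a1 * b by apply/eqP; rewrite -tofrac_eq !tofracM e1.
have e3 : frac a * frac (d b1) + frac b1 * frac (d a) =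
          frac a1 * frac (d b) + frac b * frac (d a1).
  by rewrite -!tofracM -!tofracD -!dM e2.
apply/eqP; rewrite eqr_div ?expf_neq0 //; apply/eqP.
have -> : (frac (d a1) * frac b1 - frac a1 * frac (d b1)) * frac b ^+ 2 =
  (frac a1 * frac (d b) + frac b * frac (d a1)) * frac b1 * frac b
  - (frac a1 * frac b) * (frac (d b1) * frac b + frac (d b) * frac b1) by ring.
rewrite -e3 -e1; ring.
Qed.

Lemma quot_rule_frac a : quot_rule (frac a) = frac (d a).
Proof.
have d1 : d 1 = 0.
  by have := dM 1 1; rewrite !mul1r -[LHS]addr0 => /addrI <-.
rewrite -[frac a]divr1 -tofrac1 quot_ruleE ?oner_neq0 // d1 tofrac0 tofrac1.
by rewrite expr1n !divr1 mulr1 mulr0 subr0.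
Qed.

Lemma quot_ruleD f g : quot_rule (f + g) = quot_rule f + quot_rule g.
Proof.
have [a [b [b0 ->]]] := fraction_quot f; have [a' [b' [b'0 ->]]] :=
  fraction_quot g.
have B0 : frac b != 0 by rewrite tofrac_eq0.
have B10 : frac b' != 0 by rewrite tofrac_eq0.
rewrite addf_div // -!tofracM -tofracD !quot_ruleE ?mulf_neq0 //.
by rewrite dD !dM !(tofracD, tofracM) quot_rule_add.
Qed.

Lemma quot_ruleM f g : quot_rule (f * g) = f * quot_rule g + g * quot_rule f.
Proof.
have [a [b [b0 ->]]] := fraction_quot f; have [a' [b' [b'0 ->]]] :=
  fraction_quot g.
have B0 : frac b != 0 by rewrite tofrac_eq0.
have B10 : frac b' != 0 by rewrite tofrac_eq0.
rewrite mulf_div -!tofracM !quot_ruleE ?mulf_neq0 //.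
by rewrite !dM !(tofracD, tofracM) quot_rule_mul.
Qed.
End FractionField.

Section Derivations.
Variable k : fieldType.
Local Notation K := (K k).
Local Notation u := (@u k).
Local Notation v := (@v k).

Definition du : K -> K := quot_rule (map_poly (@deriv k)).
Definition dv : K -> K := quot_rule (@deriv {poly k}).

Lemma map_deriv_coef (p : {poly {poly k}}) i :
  (map_poly (@deriv k) p)`_i = (p`_i)^`().
Proof. by rewrite coef_map_id0 // deriv0. Qed.

Lemma map_derivD (p q : {poly {poly k}}) :
  map_poly (@deriv k) (p + q) = map_poly (@deriv k) p + map_poly (@deriv k) q.
Proof. by apply/polyP => i; rewrite coefD !map_deriv_coef coefD derivD. Qed.

Lemma map_derivM (p q : {poly {poly k}}) : map_poly (@deriv k) (p * q) =
  p * map_poly (@deriv k) q + q * map_poly (@deriv k) p.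
Proof.
apply/polyP => i; rewrite coefD map_deriv_coef [q * _]mulrC !coefM.
rewrite raddf_sum -big_split; apply: eq_bigr => j _ /=.
by rewrite !map_deriv_coef derivM addrC [X in _ + X]mulrC.
Qed.

Lemma deriv_leibniz (R : comNzRingType) (p q : {poly R}) :
  (p * q)^`() = p * q^`() + q * p^`().
Proof. by rewrite derivM addrC [X in _ + X]mulrC. Qed.

Lemma du_derivation : derivation (@cst k) du.
Proof.
split=> [c|f g|f g]; rewrite /du.
- rewrite quot_rule_frac; last exact: map_derivM.
  rewrite -[RHS]tofrac0; congr tofrac; apply/polyP => i.
  by rewrite map_deriv_coef !coefC; case: eqP => _; rewrite ?derivC ?deriv0.
- by apply: quot_ruleD; [exact: map_derivD | exact: map_derivM].
- by apply: quot_ruleM; exact: map_derivM.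
Qed.

Lemma dv_derivation : derivation (@cst k) dv.
Proof.
split=> [c|f g|f g]; rewrite /dv.
- rewrite quot_rule_frac; last exact: deriv_leibniz.
  by rewrite -[RHS]tofrac0 /= derivC.
- by apply: quot_ruleD; [exact: derivD | exact: deriv_leibniz].
- by apply: quot_ruleM; exact: deriv_leibniz.
Qed.

Lemma du_u : du u = 1.
Proof.
rewrite /du /u quot_rule_frac; last exact: map_derivM.
rewrite -tofrac1; congr tofrac; apply/polyP => i; rewrite map_deriv_coef.
by rewrite coefC coef1; case: i => [|i] /=; rewrite ?derivX ?deriv0.
Qed.

Lemma du_v : du v = 0.
Proof.
rewrite /du /v quot_rule_frac; last exact: map_derivM.
rewrite -tofrac0; congr tofrac; apply/polyP => i; rewrite map_deriv_coef.
by rewrite coefX coef0; case: eqP => _; rewrite ?deriv0 // -polyC1 derivC.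
Qed.

Lemma dv_u : dv u = 0.
Proof.
by rewrite /dv /u quot_rule_frac ?derivC ?tofrac0 //; exact: deriv_leibniz.
Qed.

Lemma dv_v : dv v = 1.
Proof.
by rewrite /dv /v quot_rule_frac ?derivX ?tofrac1 //; exact: deriv_leibniz.
Qed.

Lemma u_neq0 : u != 0. Proof. by rewrite tofrac_eq0 polyC_eq0 polyX_eq0. Qed.
Lemma v_neq0 : v != 0. Proof. by rewrite tofrac_eq0 polyX_eq0. Qed.

Lemma alg_ind (s : seq K) (S : K -> Prop) :
  (forall c, S (cst c)) -> (forall x, x \in s -> S x) ->
  (forall f g, S f -> S g -> S (f + g)) ->
  (forall f g, S f -> S g -> S (f * g)) -> forall f, f \in alg s -> S f.
Proof. by move=> Sc Sx SD SM f /asboolP; elim=> //; auto. Qed.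

Lemma evaluE (p : {poly k}) : evalu p = peval (@cst k) u p.
Proof.
elim/poly_ind: p => [|p c IH]; first by rewrite peval0 /evalu tofrac0.
rewrite pevalD pevalM pevalX pevalC -IH.
by rewrite /evalu polyCD polyCM tofracD tofracM.
Qed.

Lemma algUP (f : K) : f \in alg [:: u; v] <-> exists p, f = tofrac p.
Proof.
split.
  move: f; apply: alg_ind => [c|x|f g [p ->] [q ->]|f g [p ->] [q ->]].
  - by eexists; rewrite /cst.
  - by rewrite !inE => /orP [] /eqP ->; eexists; rewrite /u /v.
  - by exists (p + q); rewrite tofracD.
  - by exists (p * q); rewrite tofracM.
case=> p ->; elim/poly_ind: p => [|p c IH]; first by rewrite tofrac0 rpred0.
rewrite tofracD tofracM rpredD ?rpredM //; first by apply: alg_gen;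
  rewrite !inE eqxx orbT.
rewrite -/(evalu c) evaluE; apply: (peval_in _ (alg_subring _)).
  exact: alg_cst.
by apply: alg_gen; rewrite inE eqxx.
Qed.

Lemma K_ind (S : K -> Prop) : (forall c, S (cst c)) -> S u -> S v ->
  (forall f g, S f -> S g -> S (f + g)) ->
  (forall f g, S f -> S g -> S (f * g)) ->
  (forall f, S f -> S f^-1) -> forall f, S f.
Proof.
move=> Sc Su Sv SD SM SV f; have [a [b [_ ->]]] := fraction_quot f.
have H p : S (tofrac p).
  have /algUP : exists q : {poly {poly k}}, tofrac p = tofrac q by exists p.
  by apply: alg_ind => // x; rewrite !inE => /orP [] /eqP ->.
by apply: (SM _ _ (H a)); apply: SV.
Qed.

End Derivations.

(** * Differentials modulo torsion *)

Section Kaehler.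
Variables (k R : comNzRingType) (f : {rmorphism k -> R}).
Local Notation d := (kaehler_d f).

Lemma kaehler_dD a b : d (a + b) = d a + d b.
Proof.
apply/eqP; rewrite -subr_eq0 -!raddfD -raddfB /=; apply/eqP.
rewrite -[RHS](raddf0 (mproj (Defs.span (kaehler_rel f)))); apply/mproj_eq.
by rewrite subr0; apply/asboolP => N; apply; exact: KaehlerD.
Qed.

Lemma kaehler_dM a b : d (a * b) = a *: d b + b *: d a.
Proof.
apply/eqP; rewrite -subr_eq0 -!linearZ -!raddfD -raddfB /=; apply/eqP.
rewrite -[RHS](raddf0 (mproj (Defs.span (kaehler_rel f)))); apply/mproj_eq.
by rewrite subr0; apply/asboolP => N; apply; exact: KaehlerM.
Qed.

Lemma kaehler_dC c : d (f c) = 0.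
Proof.
rewrite -[RHS](raddf0 (mproj (Defs.span (kaehler_rel f)))); apply/mproj_eq.
by rewrite subr0; apply/asboolP => N; apply; exact: KaehlerC.
Qed.

Lemma kaehler_d1 : d 1 = 0.
Proof. by rewrite -(rmorph1 f) kaehler_dC. Qed.

Lemma kaehler_ind (S : kaehler f -> Prop) : S 0 ->
  (forall m n, S m -> S n -> S (m + n)) -> (forall r a, S (r *: d a)) ->
  forall m, S m.
Proof.
move=> S0 SD Sd m; have [x ->] := mprojP m.
rewrite -[x]freeg_sumE raddf_sum; elim: (dom x) => [|z s IH].
  by rewrite big_nil.
rewrite big_cons; apply: SD => //.
suff -> : << coeff z x *g z >> =
  coeff z x *: << z >> by rewrite [X in S X]linearZ_LR; apply: Sd.
by apply/eqP/freeg_eqP => t; rewrite coeffZ !coeffU mul1r.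
Qed.

End Kaehler.

Section LinearOver.
Variables (R F : comNzRingType) (iota : {rmorphism R -> F}) (M : lmodType R).
Definition linear_over (l : M -> F) : Prop :=
  forall r m n, l (r *: m + n) = iota r * l m + l n.

Variable l : M -> F.
Hypothesis lP : linear_over l.
Lemma linear_over0 : l 0 = 0.
Proof.
apply: (addrI (l 0)).
by rewrite -{1}[l 0]mul1r -{1}(rmorph1 iota) -lP scaler0 !addr0.
Qed.
Lemma linear_overZ r m : l (r *: m) = iota r * l m.
Proof. by rewrite -[r *: m]addr0 lP linear_over0 addr0. Qed.
Lemma linear_overD m n : l (m + n) = l m + l n.
Proof. by rewrite -[m]scale1r lP rmorph1 mul1r scale1r. Qed.
Lemma linear_overB m n : l (m - n) = l m - l n.
Proof. by rewrite addrC -scaleN1r lP rmorphN1 mulN1r addrC. Qed.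
Lemma linear_over_sum (I : Type) (s : seq I) (E : I -> M) :
  l (\sum_(i <- s) E i) = \sum_(i <- s) l (E i).
Proof.
elim: s => [|i s IH]; first by rewrite !big_nil linear_over0.
by rewrite !big_cons linear_overD IH.
Qed.
End LinearOver.

Section Universal.
Variables (k R : comNzRingType) (f : {rmorphism k -> R}).
Variables (F : comNzRingType) (iota : {rmorphism R -> F}).

(** A copy of F on which R acts through iota, so that a derivation into F
    extends to an R-linear map on the free module of which Omega^1 is a
    quotient. *)
Definition restr_scalars : Type := F.
HB.instance Definition _ := GRing.Zmodule.on restr_scalars.

Definition restr_scale (r : R) (x : restr_scalars) : restr_scalars :=
  iota r * (x : F).
Fact restr_scaleA a b x : restr_scale a (restr_scale b x) =
  restr_scale (a * b) x.
Proof. by rewrite /restr_scale rmorphM mulrA. Qed.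
Fact restr_scale1 : left_id 1 restr_scale.
Proof. by move=> x; rewrite /restr_scale rmorph1 mul1r. Qed.
Fact restr_scaleDr : right_distributive restr_scale +%R.
Proof. by move=> a x y; rewrite /restr_scale mulrDr. Qed.
Fact restr_scaleDl x : {morph restr_scale^~ x : a b / a + b}.
Proof. by move=> a b; rewrite /restr_scale rmorphD mulrDl. Qed.
HB.instance Definition _ := GRing.Zmodule_isLmodule.Build R restr_scalars
  restr_scaleA restr_scale1 restr_scaleDr restr_scaleDl.

Lemma kaehler_universal (D : R -> F) :
  (forall a b, D (a + b) = D a + D b) ->
  (forall a b, D (a * b) = iota a * D b + iota b * D a) ->
  (forall c, D (f c) = 0) ->
  exists lam : kaehler f -> F, linear_over iota lam /\
    (forall a, lam (kaehler_d f a) = D a).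
Proof.
move=> DD DM DC; pose L : {freeg R / R} -> restr_scalars :=
  fglift (D : R -> restr_scalars).
have LU a : L << a >> = D a by rewrite /L liftU scale1r.
have LB x y : L (x - y) = L x - L y by exact: lift_is_additive.
have L0 : L 0 = 0 by rewrite -[X in L X](subrr 0) LB subrr.
have LD x y : L (x + y) = L x + L y.
  by rewrite -{1}[y]opprK LB -[- y]sub0r LB L0 sub0r opprK.
have LZ r x : L (r *: x) = iota r * (L x : F).
  rewrite -[x]freeg_sumE; elim: (dom x) => [|z s IH].
    by rewrite big_nil scaler0 L0 mulr0.
  rewrite big_cons scalerDr !LD IH mulrDr; congr (_ + _).
  have -> : r *: << coeff z x *g z >> = << r * coeff z x *g z >>.
    by apply/eqP/freeg_eqP => t; rewrite coeffZ !coeffU mulrA.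
  by rewrite /L !liftU -[iota r * _]/(r *: (_ : restr_scalars)) scalerA.
have kerL : submod_closed [pred x | L x == 0].
  split; rewrite ?inE ?L0 // => r x y; rewrite !inE LD LZ => /eqP -> /eqP ->.
  by rewrite mulr0 addr0.
have Lspan x y : mproj (Defs.span (kaehler_rel f)) x =
  mproj (Defs.span (kaehler_rel f)) y ->
    L x = L y.
  move/mproj_eq/asboolP => /(_ (Submodule kerL)) h.
  apply/eqP; rewrite -subr_eq0 -LB; apply: h => s [a b|a b|c]; rewrite inE.
  - by rewrite LB LD !LU DD subrr.
  - by rewrite LB LD !LZ !LU DM subrr.
  - by rewrite LU DC.
exists (fun m => L (repr m)); split=> [r m n|a].
  rewrite -LZ -LD; apply: Lspan; rewrite linearP /=.
  by rewrite /mproj !reprK.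
by rewrite -LU; apply: Lspan; rewrite /mproj reprK.
Qed.

End Universal.

Section Torsion.
Variables (k R : comNzRingType) (f : {rmorphism k -> R}).
Local Notation d := (kaehler_d f).

(** This is $b^2 d(a/b)$, which makes sense in Omega^1 of a ring that
    contains a and b but not their quotient. *)
Definition dquot (a b : R) : kaehler f := b *: d a - a *: d b.

Lemma dquotD a b a' b' : dquot (a * b' + a' * b) (b * b') =
  b' ^+ 2 *: dquot a b + b ^+ 2 *: dquot a' b'.
Proof.
rewrite /dquot kaehler_dD !kaehler_dM !scalerDr !scalerN !scalerA opprD.
rewrite (AC (2*2*2) ((2*(3*6))*(4*(1*5)))) /= -!scalerBl -!scaleNr.
by congr (_ *: _ + _ *: _ + (_ *: _ + _ *: _)); ring.
Qed.

Lemma dquotM a b a' b' : dquot (a * a') (b * b') =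
  (a * b) *: dquot a' b' + (a' * b') *: dquot a b.
Proof.
rewrite /dquot !kaehler_dM !scalerDr !scalerN !scalerA opprD addrACA.
by congr (_ *: _ - _ *: _ + (_ *: _ - _ *: _)); ring.
Qed.

Lemma dquotV a b : dquot b a = - dquot a b.
Proof. by rewrite /dquot opprB. Qed.

Lemma dquot_mul a b c : a = b * c -> dquot a b = b ^+ 2 *: d c.
Proof.
by move=> ->; rewrite /dquot kaehler_dM scalerDr !scalerA [b * c]mulrC addrK.
Qed.

End Torsion.

Section TorsionCriterion.
Variables (k : fieldType) (R : comNzRingType) (f : {rmorphism k -> R}).
Variables (F : fieldType) (iota : {rmorphism R -> F}) (x y : F)
  (dx dy : F -> F).
Hypothesis iota_inj : injective iota.
Hypothesis xy : coordinates (iota \o f) x y dx dy.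
Variables c cx cy : R.
Hypotheses (c0 : c != 0) (cxE : iota cx = iota c * x)
  (cyE : iota cy = iota c * y).
Local Notation d := (kaehler_d f).

Let iota0 (r : R) : (iota r == 0) = (r == 0).
Proof. by rewrite -(inj_eq iota_inj) rmorph0. Qed.

Let mul0 (r s : R) : r != 0 -> s != 0 -> r * s != 0.
Proof. by rewrite -!iota0 rmorphM => r0 s0; rewrite mulf_neq0. Qed.

Let lreg_neq0 (r : R) : r != 0 -> GRing.lreg r.
Proof.
rewrite -iota0 => r0 s t /(congr1 iota); rewrite !rmorphM => /(mulfI r0).
exact: iota_inj.
Qed.

(** Up to a nonzero factor, dquot cx c is dx and dquot cy c is dy. Thus dspan
    g says that dg is a combination of dx and dy, after clearing
    denominators. *)
Definition dspan (g : F) : Prop := exists a b r A B,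
  [/\ b != 0, r != 0, iota a = g * iota b &
      r *: dquot f a b = A *: dquot f cx c + B *: dquot f cy c].

(** By the sum, product and quotient rules the elements g with this property
    form a subfield, which contains the constants, x and y. *)
Lemma dspanT g : dspan g.
Proof.
move: g; apply: (coord_gen xy) => [z||| g h | g h | g].
- exists (f z), 1, 1, 0, 0; split; rewrite ?oner_neq0 ?rmorph1 ?mulr1 //.
  by rewrite /dquot kaehler_dC kaehler_d1 !scaler0 subr0 scaler0 !scale0r addr0.
- exists cx, c, 1, 1, 0; split; rewrite ?oner_neq0 //; first by rewrite mulrC.
  by rewrite scale0r addr0.
- exists cy, c, 1, 0, 1; split; rewrite ?oner_neq0 //; first by rewrite mulrC.
  by rewrite scale0r add0r.
- move=> [a [b [r [A [B [b0 r0 e E]]]]]]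
  [a' [b' [r' [A' [B' [b'0 r'0 e' E']]]]]].
  exists (a * b' + a' * b), (b * b'), (r * r'),
    (r' * b' ^+ 2 * A + r * b ^+ 2 * A'), (r' * b' ^+ 2 * B + r * b ^+ 2 * B').
  split; rewrite ?mul0 //; first by rewrite rmorphD !rmorphM e e'; ring.
  rewrite dquotD scalerDr !scalerA.
  have -> : r * r' * b' ^+ 2 = (r' * b' ^+ 2) * r by ring.
  have -> : r * r' * b ^+ 2 = (r * b ^+ 2) * r' by ring.
  rewrite -[(_ * r) *: _]scalerA -[(_ * r') *: _]scalerA E E'.
  move: (dquot f cx c) (dquot f cy c) => n1 n2.
  by rewrite !scalerDr !scalerA addrACA -!scalerDl.
- move=> [a [b [r [A [B [b0 r0 e E]]]]]]
  [a' [b' [r' [A' [B' [b'0 r'0 e' E']]]]]].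
  exists (a * a'), (b * b'), (r * r'),
    (r * (a * b) * A' + r' * (a' * b') * A),
      (r * (a * b) * B' + r' * (a' * b') * B).
  split; rewrite ?mul0 //; first by rewrite !rmorphM e e'; ring.
  rewrite dquotM scalerDr !scalerA.
  have -> : r * r' * (a * b) = (r * (a * b)) * r' by ring.
  have -> : r * r' * (a' * b') = (r' * (a' * b')) * r by ring.
  rewrite -[(_ * r) *: _]scalerA -[(_ * r') *: _]scalerA E E'.
  move: (dquot f cx c) (dquot f cy c) => n1 n2.
  by rewrite !scalerDr !scalerA addrACA -!scalerDl.
- move=> [a [b [r [A [B [b0 r0 e E]]]]]].
  have [a0|a0] := eqVneq a 0.
    exists 0, 1, 1, 0, 0; split; rewrite ?oner_neq0 ?rmorph1 ?mulr1 ?rmorph0 //.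
      have /eqP : g * iota b = 0 by rewrite -e a0 rmorph0.
      by rewrite mulf_eq0 iota0 (negbTE b0) orbF => /eqP ->; rewrite invr0.
    rewrite /dquot -{1}(rmorph0 f) kaehler_dC kaehler_d1.
    by rewrite !scaler0 subr0 scaler0 !scale0r addr0.
  exists b, a, r, (- A), (- B); split => //; last first.
    by rewrite dquotV scalerN E opprD !scaleNr.
  have g0 : g != 0 by apply: contraNneq a0 => g0; rewrite -iota0 e g0 mul0r.
  by rewrite e mulKf.
Qed.

Lemma kaehler_span m : exists r A B,
  r != 0 /\ r *: m = A *: dquot f cx c + B *: dquot f cy c.
Proof.
move: m; apply: kaehler_ind =>
  [|m n [r [A [B [r0 E]]]] [r' [A' [B' [r'0 E']]]]|s a].
- by exists 1, 0, 0; rewrite oner_neq0 scaler0 !scale0r addr0.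
- exists (r * r'), (r' * A + r * A'), (r' * B + r * B'); split;
  first exact: mul0.
  move: (dquot f cx c) (dquot f cy c) E E' => n1 n2 E E'.
  rewrite scalerDr {1}[r * r']mulrC -!scalerA E E' !scalerDr !scalerA addrACA.
  by rewrite -!scalerDl.
- have [a' [b [r [A [B [b0 r0 e E]]]]]] := dspanT (iota a).
  exists (r * b ^+ 2), (s * A), (s * B); split; first by rewrite !mul0.
  have -> : (r * b ^+ 2) *: (s *: d a) = s *: (r *: (b ^+ 2 *: d a)).
    by rewrite !scalerA; congr (_ *: _); ring.
  have ea : a' = b * a by apply: iota_inj; rewrite rmorphM e mulrC.
  rewrite -(dquot_mul f ea) E; move: (dquot f cx c) (dquot f cy c) => n1 n2.
  by rewrite scalerDr !scalerA.
Qed.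

(** By kaehler_span a multiple r m of m is A dx + B dy. The extensions of the
    two partial derivatives then recover A and B, so that they vanish
    together on m only if r m = 0. *)
Lemma kaehler_torsionP (lx ly : kaehler f -> F) m :
  linear_over iota lx -> linear_over iota ly ->
  (forall a, lx (d a) = dx (iota a)) -> (forall a, ly (d a) = dy (iota a)) ->
  lx m = 0 -> ly m = 0 -> m \in torsion (kaehler f).
Proof.
move=> lxP lyP lxd lyd lxm lym; have [r [A [B [r0 E]]]] := kaehler_span m.
have key (l : _ -> F) (D : F -> F) g cg : derivation (iota \o f) D ->
    linear_over iota l -> (forall a, l (d a) = D (iota a)) ->
    iota cg = iota c * g -> l (dquot f cg c) = iota c ^+ 2 * D g.
  move=> DD lP ld e; rewrite /dquot -scaleNr addrC lP.
  by rewrite (linear_overZ lP) !ld rmorphN e (derM DD); ring.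
have linE (l : kaehler f -> F) : linear_over iota l -> l m = 0 ->
    iota A * l (dquot f cx c) + iota B * l (dquot f cy c) = 0.
  move=> lP lm; have := congr1 l E.
  by rewrite lP !(linear_overZ lP) lm mulr0 => <-.
have xE := linE _ lxP lxm; have yE := linE _ lyP lym.
have Dx := dx_der xy; have Dy := dy_der xy.
rewrite (key _ dx x) // (key _ dx y) // (dx_x xy) (dx_y xy) in xE.
rewrite (key _ dy x) // (key _ dy y) // (dy_x xy) (dy_y xy) in yE.
move/eqP: xE; move/eqP: yE; rewrite !mulr0 !mulr1 addr0 add0r !mulf_eq0.
rewrite !iota0 (negbTE c0) !orbF => /eqP B0 /eqP A0.
apply/asboolP; exists r; split; last by rewrite E A0 B0 !scale0r addr0.
exact: lreg_neq0.
Qed.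
End TorsionCriterion.

(** * Gluing conditions and dual derivations in characteristic 2 *)

Section CharTwo.
Variables (k F : fieldType) (C : k -> F) (x y : F) (dx dy : F -> F).
Hypothesis char2 : forall a : F, a + a = 0.
Hypothesis xy : coordinates C x y dx dy.
Let Dx := dx_der xy.
Let Dy := dy_der xy.

(** With this form of the hypothesis, an equality that is only valid in
    characteristic 2 is reduced to a ring identity by exhibiting c. *)
Lemma eq_char2 (c a b : F) : a - b = c + c -> a = b.
Proof. by rewrite char2 => /eqP; rewrite subr_eq0 => /eqP. Qed.

Lemma der_sqr D f : derivation C D -> D (f ^+ 2) = 0.
Proof. by move=> DD; rewrite expr2 (derM DD) char2. Qed.

Lemma derV2 D f : derivation C D -> D f^-1 = D f * f^-1 ^+ 2.
Proof.
move=> DD; rewrite (derV DD) exprVn; apply: (eq_char2 (c := - D f / f ^+ 2)).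
by ring.
Qed.

(** In characteristic 2 the square of a derivation is a derivation, because
    the mixed term 2 D f D g of the Leibniz rule vanishes. *)
Lemma der2_eq0 D : derivation C D -> D (D x) = 0 -> D (D y) = 0 ->
  forall f, D (D f) = 0.
Proof.
move=> DD hx hy; apply: (coord_gen xy) => //.
- by move=> c; rewrite (derC DD) (der0 DD).
- by move=> f g hf hg; rewrite !(derD DD) hf hg addr0.
- move=> f g hf hg; rewrite !(derM DD, derD DD) hf hg.
  by apply: (eq_char2 (c := D f * D g)); ring.
- by move=> f hf; rewrite derV2 // (derM DD) hf der_sqr // !mulr0 addr0.
Qed.

Lemma dxx f : dx (dx f) = 0.
Proof.
by apply: der2_eq0 => //; rewrite ?(dx_x xy) ?(dx_y xy) ?(der1 Dx) ?(der0 Dx).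
Qed.

Lemma dyy f : dy (dy f) = 0.
Proof.
by apply: der2_eq0 => //; rewrite ?(dy_x xy) ?(dy_y xy) ?(der1 Dy) ?(der0 Dy).
Qed.

Lemma dxy f : dx (dy f) = dy (dx f).
Proof.
move: f; apply: (coord_gen xy).
- by move=> c; rewrite (derC Dx) (derC Dy) (der0 Dx) (der0 Dy).
- by rewrite (dx_x xy) (dy_x xy) (der1 Dy) (der0 Dx).
- by rewrite (dx_y xy) (dy_y xy) (der0 Dy) (der1 Dx).
- by move=> f g hf hg; rewrite !(derD Dx, derD Dy) hf hg.
- by move=> f g hf hg; rewrite !(derM Dx, derM Dy, derD Dx, derD Dy) hf hg;
  ring.
- move=> f hf; rewrite !derV2 // (derM Dx (dy f)) (derM Dy (dx f)) hf
  !der_sqr //.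
  by rewrite !mulr0.
Qed.

Variable O : {pred F}.
Hypothesis Osub : subring_closed O.
#[local] HB.instance Definition _ := GRing.isSubringClosed.Build F O Osub.
Hypotheses (dxO : forall f, f \in O -> dx f \in O).
Hypotheses (dyO : forall f, f \in O -> dy f \in O).
Hypotheses (Ox : x \in O) (Oy : y \in O) (y0 : y != 0).

Ltac inO := in_subring Osub ltac:(first [apply: dxO | apply: dyO]).

Section SmoothGluing.
Variable R : F.
Hypotheses (OR : R \in O) (dyR : dy R = 0).

(** Let B be the scheme y^2 = 0 in the plane with coordinates x and y. The
    subring of O_B generated over k by x + yR consists of the f0 + f1 y with
    f1 = R f0'. Hence it is the kernel of the derivation dy - R dx,
    considered modulo y. *)
Definition glued_smooth (f : F) : Prop :=
  f \in O /\ exists2 e, e \in O & dy f - R * dx f = y * e.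

Lemma glued_smooth_const c : C c \in O -> glued_smooth (C c).
Proof.
split => //; exists 0; first exact: rpred0.
by rewrite (derC Dx) (derC Dy) !mulr0 subr0.
Qed.

Lemma glued_smoothD f g : glued_smooth f -> glued_smooth g ->
  glued_smooth (f + g).
Proof.
move=> [Of [e Oe fe]] [Og [e' Oe' ge]]; split; first exact: rpredD.
exists (e + e'); first exact: rpredD.
by rewrite mulrDr -fe -ge (derD Dx) (derD Dy); ring.
Qed.

Lemma glued_smoothM f g : glued_smooth f -> glued_smooth g ->
  glued_smooth (f * g).
Proof.
move=> [Of [e Oe fe]] [Og [e' Oe' ge]]; split; first exact: rpredM.
exists (f * e' + g * e); first by rewrite rpredD ?rpredM.
rewrite (derM Dx) (derM Dy).
have -> : y * (f * e' + g * e) = f * (y * e') + g * (y * e) by ring.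
by rewrite -fe -ge; ring.
Qed.

Lemma glued_smooth_sqr f : f \in O -> glued_smooth (f ^+ 2).
Proof.
move=> Of; split; first exact: rpredX.
by exists 0; rewrite ?rpred0 // !der_sqr // !mulr0 subr0.
Qed.

Lemma glued_smoothV f : glued_smooth f -> f^-1 \in O -> glued_smooth f^-1.
Proof.
move=> hf Of; have [->|f0] := eqVneq f 0.
  by rewrite invr0 -[0](expr0n _ 2); apply/glued_smooth_sqr/rpred0.
have -> : f^-1 = f * f^-1 ^+ 2 by field.
by apply: glued_smoothM => //; apply: glued_smooth_sqr.
Qed.

Lemma glued_smooth_ideal t : t \in O -> glued_smooth (y ^+ 2 * t).
Proof.
move=> Ot; split; first by rewrite rpredM ?rpredX.
exists (y * (dy t - R * dx t));
  first by rewrite rpredM ?rpredB ?rpredM ?dxO ?dyO.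
by rewrite (derM Dx) (derM Dy) !der_sqr // !mulr0 !addr0; ring.
Qed.

Lemma glued_smooth_par : glued_smooth (x + y * R).
Proof.
split; first by rewrite rpredD ?rpredM.
exists (- (R * dx R)); first by rewrite rpredN rpredM // dxO.
rewrite (derD Dx) (derD Dy) (derM Dx) (derM Dy) dyR (dx_x xy) (dx_y xy).
by rewrite (dy_x xy) (dy_y xy); ring.
Qed.

Let J := 1 + y * dx R.
Hypotheses (J0 : J != 0) (OJ : J^-1 \in O).

Definition smooth1 f := dx f / J.
Definition smooth2 f := (dy f - R * smooth1 f) / y ^+ 2.

Lemma dx_J : dx J = 0.
Proof.
by rewrite (derD Dx) (der1 Dx) (derM Dx) dxx (dx_y xy) !mulr0 !addr0.
Qed.

Lemma dy_J : dy J = dx R.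
Proof.
rewrite (derD Dy) (der1 Dy) (derM Dy) -dxy dyR (der0 Dx) (dy_y xy).
by rewrite mulr0 mulr1 !add0r.
Qed.

Lemma dx_smooth1 f : dx (smooth1 f) = 0.
Proof.
by rewrite /smooth1 (der_div Dx) // dxx dx_J mul0r mulr0 subr0 mul0r.
Qed.

Lemma dy_smooth1 f : J * dy (smooth1 f) = dy (dx f) - dx R * smooth1 f.
Proof. by rewrite /smooth1 (der_div Dy) // dy_J; field. Qed.

(** Let h be the first dual derivative of f and q the numerator of the second
    one. Since dx (dx f) = dy (dy f) = 0, the derivatives of q are multiples
    of dy h, namely J dy h and - R dy h. The gluing condition says that y
    divides q; then y divides dx q, hence dy h, hence dy q, and therefore y^2
    divides q. *)
Lemma glued_smooth_dual f : glued_smooth f ->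
  glued_smooth (smooth1 f) /\ glued_smooth (smooth2 f).
Proof.
move=> [Of [e Oe fe]]; pose h := smooth1 f; pose q := dy f - R * h.
have Oh : h \in O by rewrite /h /smooth1 rpredM ?dxO.
have Jh : J * h = dx f by rewrite /h /smooth1 mulrC divfK.
have dxq : dx q = J * dy h.
  by rewrite dy_smooth1 (derB Dx) (derM Dx) dx_smooth1 dxy mulr0 add0r mulrC.
have dyq : dy q = - (R * dy h).
  by rewrite (derB Dy) dyy (derM Dy) dyR mulr0 addr0 sub0r.
pose y1 := e + R * h * dx R.
have qy1 : q = y * y1.
  by rewrite /y1 mulrDr -fe -Jh /q /J; ring.
have Oy1 : y1 \in O by rewrite rpredD ?rpredM // dxO.
have dyh : dy h = y * (dx y1 / J).
  apply: (mulfI J0); rewrite -dxq qy1 (derM Dx) (dx_y xy) mulr0 addr0.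
  by field.
pose t := - (R * dx y1 / J) - dy y1.
have y1t : y1 = y * t.
  have := dyq; rewrite {1}qy1 (derM Dy) (dy_y xy) mulr1 dyh => E.
  have -> : y1 = (y * dy y1 + y1) - y * dy y1 by ring.
  by rewrite E /t; field.
have Ot : t \in O by rewrite rpredB ?rpredN ?rpredM ?dxO ?dyO.
have qt : q = y ^+ 2 * t by rewrite qy1 y1t; ring.
have tE : smooth2 f = t.
  by rewrite /smooth2 -/h -/q qt mulrC mulrA mulVf ?mul1r ?expf_neq0.
split; split => //.
- exists (dx y1 / J); first by rewrite rpredM ?dxO.
  by rewrite dyh dx_smooth1 mulr0 subr0.
- by rewrite tE.
have y20 : y ^+ 2 != 0 by rewrite expf_neq0.
have dxt : dy h = y ^+ 2 * (dx t / J).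
  apply: (mulfI J0); rewrite -dxq qt (derM Dx) der_sqr // mulr0 addr0.
  by field.
have dyt : dy t = - (R * (dx t / J)).
  apply: (mulfI y20); have := dyq.
  rewrite {1}qt (derM Dy) der_sqr // mulr0 addr0 => ->.
  by rewrite dxt; ring.
exists (R * dx t * dx R / J); first by rewrite !rpredM ?dxO.
rewrite tE dyt; apply: (eq_char2 (c := - (R * dx t / J * (1 + y * dx R)))).
by rewrite /J; field.
Qed.

Lemma dx_par : dx (x + y * R) = J.
Proof. by rewrite (derD Dx) (derM Dx) (dx_x xy) (dx_y xy) mulr0 addr0. Qed.

Lemma dy_par : dy (x + y * R) = R.
Proof.
by rewrite (derD Dy) (derM Dy) dyR (dy_x xy) (dy_y xy) mulr0 mulr1 !add0r.
Qed.

Lemma dx_cube : dx (y ^+ 3) = 0.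
Proof. by rewrite exprS (derM Dx) der_sqr // (dx_y xy) !mulr0 addr0. Qed.

Lemma dy_cube : dy (y ^+ 3) = y ^+ 2.
Proof. by rewrite exprS (derM Dy) der_sqr // (dy_y xy) mulr0 add0r mulr1. Qed.

Lemma smooth_basis :
  [/\ smooth1 (x + y * R) = 1, smooth2 (x + y * R) = 0,
      smooth1 (y ^+ 3) = 0 & smooth2 (y ^+ 3) = 1].
Proof.
rewrite /smooth2 /smooth1 dx_par dy_par dx_cube dy_cube divff // mulr1 subrr.
by rewrite !mul0r mulr0 subr0 divff // expf_neq0.
Qed.

Lemma smooth_derivation : derivation C smooth1 /\ derivation C smooth2.
Proof.
have D1 : derivation C smooth1.
  rewrite /smooth1; split=> [c|f g|f g].
  - by rewrite (derC Dx) mul0r.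
  - by rewrite (derD Dx) mulrDl.
  - by rewrite (derM Dx); field.
split => //; rewrite /smooth2; split=> [c|f g|f g].
- by rewrite (derC Dy) (derC D1) mulr0 subr0 mul0r.
- by rewrite (derD Dy) (derD D1); field.
- by rewrite (derM Dy) (derM D1); field.
Qed.

Lemma smooth_expand f :
  dx f = smooth1 f * dx (x + y * R) + smooth2 f * dx (y ^+ 3) /\
  dy f = smooth1 f * dy (x + y * R) + smooth2 f * dy (y ^+ 3).
Proof.
rewrite dx_par dy_par dx_cube dy_cube mulr0 addr0 /smooth2 /smooth1 divfK //;
  split=> //.
by rewrite divfK ?expf_neq0 //; ring.
Qed.

End SmoothGluing.

Section CuspGluing.
Variable P : F.
Hypotheses (OP : P \in O) (OPV : P^-1 \in O) (P0 : P != 0) (dyP : dy P = 0).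

Definition cusp1 f := dy f / P.
Definition cusp2 f := (dx f - cusp1 f * (x ^+ 2 + y * dx P)) / y ^+ 2.

(** Let B be the scheme y^2 = 0 in the plane with coordinates x and y. In
    characteristic 2 the subring of O_B generated over k by x^2 and x^3 + yP
    consists of the g + h (x^3 + yP) with g and h in k[x^2]. For such an
    element f, h is recovered modulo y as cusp1 f, and what characterizes f
    is that dx f = x^2 h and dx h = 0 modulo y. *)
Definition glued_cusp (f : F) : Prop :=
  [/\ f \in O,
      exists2 e, e \in O & dx f = x ^+ 2 * cusp1 f + y * e &
      exists2 e, e \in O & dx (cusp1 f) = y * e].

Lemma cusp1D f g : cusp1 (f + g) = cusp1 f + cusp1 g.
Proof. by rewrite /cusp1 (derD Dy) mulrDl. Qed.

Lemma cusp1M f g : cusp1 (f * g) = f * cusp1 g + g * cusp1 f.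
Proof. by rewrite /cusp1 (derM Dy); field. Qed.

Lemma cusp1_sqr f : cusp1 (f ^+ 2) = 0.
Proof. by rewrite /cusp1 der_sqr // mul0r. Qed.

Lemma cusp1O f : f \in O -> cusp1 f \in O.
Proof. by move=> Of; rewrite rpredM ?dyO. Qed.

Lemma glued_cusp_const c : C c \in O -> glued_cusp (C c).
Proof.
split => //; exists 0; rewrite ?rpred0 // /cusp1 (derC Dy) mul0r.
  by rewrite (derC Dx) !mulr0 addr0.
by rewrite (der0 Dx) mulr0.
Qed.

Lemma glued_cuspD f g : glued_cusp f -> glued_cusp g -> glued_cusp (f + g).
Proof.
move=> [Of [e Oe fe] [e1 Oe1 fe1]] [Og [e' Oe' ge] [e1' Oe1' ge1]].
split; first exact: rpredD.
  exists (e + e'); first exact: rpredD.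
  by rewrite cusp1D (derD Dx) fe ge; ring.
exists (e1 + e1'); first exact: rpredD.
by rewrite cusp1D (derD Dx) fe1 ge1; ring.
Qed.

(** Modulo y, the mixed terms dx f * cusp1 g and dx g * cusp1 f of dx (cusp1
    (f g)) are both x^2 * cusp1 f * cusp1 g, so they cancel. *)
Lemma glued_cuspM f g : glued_cusp f -> glued_cusp g -> glued_cusp (f * g).
Proof.
move=> [Of [e Oe fe] [e1 Oe1 fe1]] [Og [e' Oe' ge] [e1' Oe1' ge1]].
split; first exact: rpredM.
  exists (f * e' + g * e); first by rewrite rpredD ?rpredM.
  by rewrite cusp1M (derM Dx) fe ge; ring.
exists (f * e1' + g * e1 + e * cusp1 g + e' * cusp1 f).
  have Hf := cusp1O Of; have Hg := cusp1O Og.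
  by rewrite !rpredD //; apply: rpredM.
rewrite cusp1M (derD Dx) (derM Dx f) (derM Dx g) fe1 ge1 fe ge.
by apply: (eq_char2 (c := x ^+ 2 * cusp1 f * cusp1 g)); ring.
Qed.

Lemma glued_cusp_sqr f : f \in O -> glued_cusp (f ^+ 2).
Proof.
move=> Of; split; first exact: rpredX.
  by exists 0; rewrite ?rpred0 // cusp1_sqr der_sqr // !mulr0 addr0.
by exists 0; rewrite ?rpred0 // cusp1_sqr (der0 Dx) mulr0.
Qed.

Lemma glued_cuspV f : glued_cusp f -> f^-1 \in O -> glued_cusp f^-1.
Proof.
move=> hf Of; have [->|f0] := eqVneq f 0.
  by rewrite invr0 -[0](expr0n _ 2); apply/glued_cusp_sqr/rpred0.
have -> : f^-1 = f * f^-1 ^+ 2 by field.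
by apply: glued_cuspM => //; apply: glued_cusp_sqr.
Qed.

Lemma glued_cusp_ideal t : t \in O -> glued_cusp (y ^+ 2 * t).
Proof.
move=> Ot; have E : cusp1 (y ^+ 2 * t) = y ^+ 2 * cusp1 t.
  by rewrite cusp1M cusp1_sqr mulr0 addr0.
split; first by rewrite rpredM ?rpredX.
  exists (y * (dx t - x ^+ 2 * cusp1 t)).
    by have := cusp1O Ot => Ht; inO.
  by rewrite E (derM Dx) der_sqr // mulr0 addr0; ring.
exists (y * dx (cusp1 t)); first by have := cusp1O Ot => Ht; inO.
by rewrite E (derM Dx) der_sqr // mulr0 addr0; ring.
Qed.

Let z := x ^+ 3 + y * P.

Lemma dx_z : dx z = x ^+ 2 + y * dx P.
Proof.
rewrite (derD Dx) exprS (derM Dx x) (derM Dx y) der_sqr // (dx_x xy) (dx_y xy).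
by rewrite !mulr0 add0r addr0 mulr1.
Qed.

Lemma dy_z : dy z = P.
Proof.
rewrite (derD Dy) exprS (derM Dy x) (derM Dy y) der_sqr // (dy_x xy)
  (dy_y xy) dyP.
by rewrite !mulr0 !add0r mulr1.
Qed.

Lemma glued_cusp_z : glued_cusp z.
Proof.
have E : cusp1 z = 1 by rewrite /cusp1 dy_z divff.
split; first by rewrite rpredD ?rpredX ?rpredM.
  by exists (dx P); rewrite ?dxO // E dx_z mulr1.
by exists 0; rewrite ?rpred0 // E (der1 Dx) mulr0.
Qed.

Lemma dy_cusp1 f : dy (cusp1 f) = 0.
Proof. by rewrite /cusp1 (der_div Dy) // dyy dyP mul0r mulr0 subr0 mul0r. Qed.

(** With h = cusp1 f and q = y^2 (cusp2 f), we have dy h = 0 and dy q = P dx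
    h. Since y divides q and dx h, it divides dy q, so y^2 divides q.
    Moreover dy (dx h) = 0, so that y^2 also divides dx h, and this gives the
    conditions on the quotient q / y^2. *)
Lemma glued_cusp_dual f : glued_cusp f ->
  glued_cusp (cusp1 f) /\ glued_cusp (cusp2 f).
Proof.
move=> [Of [e1 Oe1 fe1] [e2 Oe2 fe2]]; pose h := cusp1 f.
have Oh : h \in O by rewrite cusp1O.
have dyh : dy h = 0 by rewrite dy_cusp1.
have cusp1h : cusp1 h = 0 by rewrite /cusp1 dyh mul0r.
split; first by split => //; rewrite cusp1h; [exists e2 | exists 0];
  rewrite ?rpred0 ?mulr0 ?add0r ?(der0 Dx).
pose q := dx f - h * (x ^+ 2 + y * dx P).
pose y1 := e1 - h * dx P.
have qy1 : q = y * y1 by rewrite /q fe1 -/h /y1; ring.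
have Oy1 : y1 \in O by rewrite /y1; inO.
have Ph : P * dx h = dy (dx f) - h * dx P.
  by rewrite /h /cusp1 (der_div Dx) // dxy; field.
have dyq : dy q = P * dx h.
  rewrite Ph (derB Dy) (derM Dy) dyh (derD Dy) der_sqr // (derM Dy)
    -(dxy P) dyP.
  by rewrite (der0 Dx) (dy_y xy) !mulr0 addr0 !add0r mulr1.
pose t := P * e2 - dy y1.
have y1t : y1 = y * t.
  have := dyq; rewrite qy1 fe2 (derM Dy) (dy_y xy) mulr1 => E.
  have -> : y1 = (y * dy y1 + y1) - y * dy y1 by ring.
  by rewrite E /t; ring.
have Ot : t \in O by rewrite rpredB ?rpredM ?dyO.
have qt : q = y ^+ 2 * t by rewrite qy1 y1t; ring.
have y20 : y ^+ 2 != 0 by rewrite expf_neq0.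
have tE : cusp2 f = t by rewrite /cusp2 -/h -/q qt mulrC mulKf.
pose m := - dy e2.
have Om : m \in O by rewrite rpredN dyO.
have e2m : e2 = y * m.
  have : dy (dx h) = 0 by rewrite -dxy dyh (der0 Dx).
  rewrite fe2 (derM Dy) (dy_y xy) mulr1 => E.
  by rewrite /m mulrN; apply/eqP; rewrite -addr_eq0 addrC E.
have dxh : dx h = y ^+ 2 * m by rewrite fe2 e2m; ring.
have dyt : dy t = P * m.
  apply: (mulfI y20); have := dyq; rewrite qt (derM Dy) der_sqr // mulr0 addr0.
  by move=> ->; rewrite dxh; ring.
have dxt : dx t = - (m * (x ^+ 2 + y * dx P)).
  apply: (mulfI y20); have : dx q = - (dx h * (x ^+ 2 + y * dx P)).
    rewrite (derB Dx) dxx (derM Dx) (derD Dx) der_sqr // (derM Dx) dxx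
      (dx_y xy).
    by rewrite !mulr0 !addr0 mulr0 !add0r mulrC.
  by rewrite qt (derM Dx) der_sqr // mulr0 addr0 dxh => ->; ring.
have cusp1t : cusp1 t = m by rewrite /cusp1 dyt mulrC mulKf.
have dxm : dx m = 0.
  apply: (mulfI y20); rewrite mulr0 -(dxx h) dxh (derM Dx) der_sqr //.
  by rewrite mulr0 addr0.
rewrite tE; split => //; rewrite cusp1t.
  exists (- (m * dx P)); first by rewrite rpredN rpredM ?dxO.
  by rewrite dxt; apply: (eq_char2 (c := - (m * x ^+ 2))); ring.
by exists 0; rewrite ?rpred0 // dxm mulr0.
Qed.

Lemma cusp_basis :
  [/\ cusp1 z = 1, cusp2 z = 0, cusp1 (y ^+ 2 * x) =
    0 & cusp2 (y ^+ 2 * x) = 1].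
Proof.
have E1 : cusp1 z = 1 by rewrite /cusp1 dy_z divff.
have E2 : cusp1 (y ^+ 2 * x) = 0.
  by rewrite cusp1M cusp1_sqr mulr0 /cusp1 (dy_x xy) mul0r mulr0 addr0.
rewrite /cusp2 E1 E2 dx_z mul1r subrr !mul0r subr0 (derM Dx) der_sqr //.
by rewrite (dx_x xy) mulr0 addr0 mulr1 divff // expf_neq0.
Qed.

Lemma cusp_derivation : derivation C cusp1 /\ derivation C cusp2.
Proof.
have D1 : derivation C cusp1.
  split=> [c|f g|f g]; [|exact: cusp1D|exact: cusp1M].
  by rewrite /cusp1 (derC Dy) mul0r.
split => //; rewrite /cusp2; split=> [c|f g|f g].
- by rewrite (derC Dx) (derC D1) mul0r subr0 mul0r.
- by rewrite (derD Dx) cusp1D; field.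
- by rewrite (derM Dx) cusp1M; field.
Qed.

Lemma cusp_expand f :
  dx f = cusp1 f * dx z + cusp2 f * dx (y ^+ 2 * x) /\
  dy f = cusp1 f * dy z + cusp2 f * dy (y ^+ 2 * x).
Proof.
rewrite dx_z dy_z (derM Dx) (derM Dy) !der_sqr // (dx_x xy) (dy_x xy).
rewrite !mulr0 !addr0 mulr1 mulr0 addr0 /cusp2 divfK ?expf_neq0 //.
by split; [ring | rewrite /cusp1 divfK].
Qed.

End CuspGluing.
End CharTwo.

(** * Localizations of subrings of a field *)

Section Subring.
Variables (F : fieldType) (O : {pred F}).
Hypothesis Osub : subring_closed O.
#[local] HB.instance Definition _ := GRing.isSubringClosed.Build F O Osub.

Definition unit_in (f : F) : bool := (f != 0) && (f^-1 \in O).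

Lemma unit_in_neq0 f : unit_in f -> f != 0. Proof. by case/andP. Qed.
Lemma unit_in_inv f : unit_in f -> f^-1 \in O. Proof. by case/andP. Qed.

Lemma unit_in1 : unit_in 1.
Proof. by rewrite /unit_in oner_neq0 invr1 rpred1. Qed.

Lemma unit_inM f g : unit_in f -> unit_in g -> unit_in (f * g).
Proof.
by move=> /andP [f0 fO] /andP [g0 gO];
  rewrite /unit_in mulf_neq0 // invfM rpredM.
Qed.

Lemma unit_inV f : f \in O -> f != 0 -> unit_in f^-1.
Proof. by move=> fO f0; rewrite /unit_in invr_eq0 f0 invrK. Qed.

Lemma unit_in_mulr f g : f \in O -> unit_in (f * g) -> unit_in g.
Proof.
move=> fO /andP []; rewrite mulf_eq0 negb_or => /andP [f0 g0] fgO.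
by rewrite /unit_in g0 -[g^-1]mul1r -(divff f0) -mulrA -invfM rpredM.
Qed.

Definition fracs (S : {pred F}) (f : F) : Prop :=
  exists a b, [/\ a \in S, b \in S, unit_in b & f = a / b].

Section Fractions.
Variable S : {pred F}.
Hypothesis Ssub : subring_closed S.
#[local] HB.instance Definition _ := GRing.isSubringClosed.Build F S Ssub.

Lemma fracs_gen f : f \in S -> fracs S f.
Proof. by move=> fS; exists f, 1; rewrite divr1 unit_in1 rpred1. Qed.

Lemma fracsD f g : fracs S f -> fracs S g -> fracs S (f + g).
Proof.
move=> [a [b [aS bS ub ->]]] [a' [b' [a'S b'S ub' ->]]].
exists (a * b' + a' * b), (b * b').
split; rewrite ?unit_inM ?rpredD ?rpredM //.
by rewrite addf_div ?unit_in_neq0.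
Qed.

Lemma fracsM f g : fracs S f -> fracs S g -> fracs S (f * g).
Proof.
move=> [a [b [aS bS ub ->]]] [a' [b' [a'S b'S ub' ->]]].
by exists (a * a'), (b * b'); split; rewrite ?unit_inM ?rpredM ?mulf_div.
Qed.

Lemma fracsV f : fracs S f -> f^-1 \in O -> fracs S f^-1.
Proof.
have [->|f0] := eqVneq f 0; first by rewrite invr0.
move=> [a [b [aS bS ub e]]] fO.
exists b, a; split => //; last by rewrite e invf_div.
have -> : a = f * b by rewrite e divfK ?unit_in_neq0.
by rewrite unit_inM // /unit_in f0.
Qed.

Lemma fracs_inv f : fracs S f^-1 -> f \in O -> fracs S f.
Proof. by move=> h fO; rewrite -[f]invrK; apply: fracsV; rewrite ?invrK. Qed.

End Fractions.

Section Localization.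
Variables A p : {pred F}.
Hypotheses (Asub : subring_closed A) (p0 : 0 \in p) (p1 : 1 \notin p).
Hypothesis plin : forall a b c,
  a \in A -> b \in p -> c \in p -> a * b + c \in p.
Hypothesis OE : forall f, f \in O <->
  exists a b, [/\ a \in A, b \in A, b \notin p & f = a / b].
#[local] HB.instance Definition _ := GRing.isSubringClosed.Build F A Asub.

(** This describes the prime p through O alone, so that a point can be moved
    from one chart to another. *)
Lemma unit_in_local a : a \in A -> (a \notin p) = unit_in a.
Proof.
move=> aA; apply/idP/idP => [ap|/andP [a0]].
  rewrite /unit_in (contraNneq _ ap) => [/=|-> //].
  by apply/OE; exists 1, a; rewrite rpred1 mul1r.
move/OE=> [m [n [mc nc np e]]]; apply: contra np => ap.
have n0 : n != 0.
  by apply: contra_neq a0 => n0; rewrite -[a]invrK e n0 invr0 mulr0 invr0.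
have -> : n = m * a + 0.
  by rewrite addr0 -[m](mulfVK n0) mulrAC -[m * n^-1]e mulVf // mul1r.
exact: plin.
Qed.

Lemma local_fracs f : f \in O -> fracs A f.
Proof.
by move/OE=> [a [b [aA bA bp e]]]; exists a, b; rewrite -unit_in_local.
Qed.

Lemma local_sub : {subset A <= O}.
Proof. by move=> a aA; apply/OE; exists a, 1; rewrite divr1 rpred1. Qed.

Lemma nonunitD f g : f \in O -> g \in O -> unit_in (f + g) ->
  unit_in f || unit_in g.
Proof.
have num a b : a \in A -> b \in A -> unit_in b -> unit_in (a / b) = unit_in a.
  move=> aA bA ub; apply/idP/idP=> h.
    by rewrite -[a](divfK (unit_in_neq0 ub)); apply: unit_inM.
  by apply: unit_inM => //; apply: unit_inV; rewrite ?local_sub ?unit_in_neq0.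
move=> /local_fracs [a [b [aA bA ub ->]]] /local_fracs
  [a' [b' [a'A b'A ub' ->]]].
rewrite addf_div ?unit_in_neq0 // !num ?rpredD ?rpredM ?unit_inM //.
rewrite -!unit_in_local ?rpredD ?rpredM //; apply: contraR.
rewrite negb_or !negbK => /andP [ap a'p]; rewrite mulrC; apply: plin => //.
by rewrite mulrC -[b * a']addr0; apply: plin.
Qed.

End Localization.

Section NewChart.
Variable A : {pred F}.
Hypothesis Asub : subring_closed A.
#[local] HB.instance Definition _ := GRing.isSubringClosed.Build F A Asub.
Hypotheses (AO : {subset A <= O}) (OA : forall f, f \in O -> fracs A f).
Hypothesis nonunit_add : forall f g, f \in O -> g \in O -> unit_in (f + g) ->
  unit_in f || unit_in g.

Definition nonunits : {pred F} := fun f => (f \in A) && ~~ unit_in f.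

Lemma nonunitsE f : (f \in nonunits) = (f \in A) && ~~ unit_in f.
Proof. by []. Qed.

(** If the local ring O contains the coordinate ring A of another affine
    chart, then the point lies in that chart, at the prime where the maximal
    ideal meets A. *)
Lemma nonunits_prime :
  [/\ {subset nonunits <= A}, 0 \in nonunits, 1 \notin nonunits,
      forall a b c, a \in A -> b \in nonunits -> c \in nonunits ->
        a * b + c \in nonunits &
      forall a b, a \in A -> b \in A -> a * b \in nonunits ->
        (a \in nonunits) || (b \in nonunits)].
Proof.
split.
- by move=> f /andP [].
- by rewrite nonunitsE rpred0 /unit_in eqxx.
- by rewrite nonunitsE unit_in1 andbF.
- move=> a b c aA /andP [bA ub] /andP [cA uc];
  rewrite nonunitsE rpredD ?rpredM //.
  apply/negP => /nonunit_add;
    rewrite (negbTE uc) orbF !AO ?rpredM // => /(_ isT isT).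
  by move=> h; case/negP: ub; apply: unit_in_mulr h; apply: AO.
- move=> a b aA bA; rewrite !nonunitsE aA bA rpredM //= -negb_and.
  by apply: contra => /andP [ua ub]; apply: unit_inM.
Qed.

Lemma nonunits_loc f : f \in O <->
  exists a b, [/\ a \in A, b \in A, b \notin nonunits & f = a / b].
Proof.
split=> [/OA [a [b [aA bA ub e]]]|[a [b [aA bA]]]].
  by exists a, b; split => //; rewrite nonunitsE ub andbF.
rewrite nonunitsE bA negbK => /= ub ->; rewrite rpredM //; first exact: AO.
exact: unit_in_inv.
Qed.
End NewChart.
End Subring.

(** * Germs satisfying the gluing conditions come from the curve *)

(** If b = c + ye then b^2 = c^2 + y^2 e^2 in characteristic 2. Replacing the
    denominator b^2 by c^2 thus changes the quotient by a multiple of y^2. *)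
Lemma quot_mod_square (F : fieldType) (a t b c e y : F) : b != 0 -> c != 0 ->
  b ^+ 2 = c ^+ 2 + y ^+ 2 * e ^+ 2 ->
  (a + y ^+ 2 * t) / b ^+ 2 =
  a / c ^+ 2 + y ^+ 2 * (t / b ^+ 2 - a * e ^+ 2 / (b ^+ 2 * c ^+ 2)).
Proof.
move=> b0 c0 bE; have E : y ^+ 2 * e ^+ 2 = b ^+ 2 - c ^+ 2 by rewrite bE; ring.
have -> : a / c ^+ 2 + y ^+ 2 * (t / b ^+ 2 - a * e ^+ 2 / (b ^+ 2 * c ^+ 2)) =
  a / c ^+ 2 + y ^+ 2 * t / b ^+ 2 - a * (y ^+ 2 * e ^+ 2) / (b ^+ 2 * c ^+ 2).
  by field; rewrite b0 c0.
by rewrite E; field; rewrite b0 c0.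
Qed.

Section Gluing.
Variables (k F : fieldType) (C : {rmorphism k -> F}) (x y : F) (dx dy : F -> F).
Hypothesis kchar2 : forall a : k, a + a = 0.
Hypothesis xy : coordinates C x y dx dy.
Variables A O : {pred F}.
Hypotheses (Asub : subring_closed A) (Osub : subring_closed O).
#[local] HB.instance Definition _ := GRing.isSubringClosed.Build F A Asub.
#[local] HB.instance Definition _ := GRing.isSubringClosed.Build F O Osub.
Hypotheses (AC : forall c, C c \in A) (Ax : x \in A) (Ay : y \in A).
Hypotheses (AO : {subset A <= O}) (OA : forall f, f \in O -> fracs O A f).
Hypothesis Aexp : forall a, a \in A -> exists a0 a1 : {poly k},
  exists2 a2, a2 \in A & a = peval C x a0 + peval C x a1 * y + y ^+ 2 * a2.
Hypothesis yO : ~~ unit_in O y.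
Hypothesis nonunit_add : forall f g, f \in O -> g \in O -> unit_in O (f + g) ->
  unit_in O f || unit_in O g.
Let Dx := dx_der xy.
Let Dy := dy_der xy.
Local Notation ev := (peval C).

Let char2 (a : F) : a + a = 0.
Proof.
by rewrite -[a]mulr1 -mulrDr -(rmorph1 C) -rmorphD kchar2 rmorph0 mulr0.
Qed.

Let pchar2 (p : {poly k}) : p + p = 0.
Proof. by apply/polyP => i; rewrite coefD coef0 kchar2. Qed.

Lemma deriv_sqr (p : {poly k}) : (p ^+ 2)^`() = 0.
Proof. by rewrite expr2 derivM mulrC pchar2. Qed.

Hypotheses (dxO : forall f, f \in O -> dx f \in O).
Hypotheses (dyO : forall f, f \in O -> dy f \in O).

Lemma unit_mod_y b b' : b \in O -> b' \in O -> unit_in O (b + y * b') ->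
  unit_in O b.
Proof.
move=> Ob Ob' h; have Oy := AO Ay.
have Oyb : y * b' \in O by apply: rpredM.
have := nonunit_add Ob Oyb h; case/orP => //;
  rewrite mulrC => /(unit_in_mulr Osub Ob') uy.
by case/negP: yO.
Qed.

Let dx_ev p : dx (ev x p) = ev x p^`().
Proof. by rewrite (der_peval _ _ Dx) (dx_x xy) mulr1. Qed.
Let dy_ev p : dy (ev x p) = 0.
Proof. by rewrite (der_peval _ _ Dy) (dy_x xy) mulr0. Qed.

(** A square is a constant for every derivation in characteristic 2, so that
    f and its numerator a satisfy the same linear differential conditions. *)
Lemma square_denominator f : f \in O -> exists a b,
  [/\ a \in A, b \in A, unit_in O b & f = a / b ^+ 2].
Proof.
move=> /OA [a [b [aA bA ub e]]]; exists (a * b), b; split => //.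
  exact: rpredM.
by rewrite e expr2 -mulf_div divff ?(unit_in_neq0 ub) // mulr1.
Qed.

Lemma der_mul_sqr D f b : derivation C D -> D (f * b ^+ 2) = D f * b ^+ 2.
Proof.
by move=> DD; rewrite (derM DD) (der_sqr char2 _ DD) mulr0 add0r mulrC.
Qed.

Lemma dx_expansion a0 a1 a2 : dx (ev x a0 + ev x a1 * y + y ^+ 2 * a2) =
  ev x a0^`() + ev x a1^`() * y + y ^+ 2 * dx a2.
Proof.
rewrite !(derD Dx) (derM Dx (ev x a1)) (derM Dx (y ^+ 2)).
by rewrite (der_sqr char2 _ Dx) (dx_y xy) !dx_ev; ring.
Qed.

Lemma dy_expansion a0 a1 a2 : dy (ev x a0 + ev x a1 * y + y ^+ 2 * a2) =
  ev x a1 + y ^+ 2 * dy a2.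
Proof.
rewrite !(derD Dy) (derM Dy (ev x a1)) (derM Dy (y ^+ 2)).
by rewrite (der_sqr char2 _ Dy) (dy_y xy) !dy_ev; ring.
Qed.

(** Write the numerator of f as a0 + a1 y modulo y^2. The gluing condition is
    a1 = R a0' modulo y. By Taylor's formula the numerator is therefore a0 (x
    + yR) modulo y^2. *)
Lemma glued_smooth_exists R f : R \in A -> dy R = 0 ->
  glued_smooth y dx dy O R f ->
  exists p q : {poly k}, exists t, [/\ t \in O, unit_in O (ev (x + y * R) q) &
    f = ev (x + y * R) p / ev (x + y * R) q ^+ 2 + y ^+ 2 * t].
Proof.
move=> AR dyR [Of [e Oe fe]].
have [a [b [aA bA ub fE]]] := square_denominator Of.
have [a0 [a1 [a2 a2A aE]]] := Aexp aA.
have [b0 [b1 [b2 b2A bE]]] := Aexp bA.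
pose w := x + y * R.
have yRA : y * R \in A by apply: rpredM.
have wA : w \in A by apply: rpredD.
have evA z p : z \in A -> ev z p \in A by apply: peval_in.
have OR := AO AR; have Ox := AO Ax; have Oy := AO Ay.
have Oa2 := AO a2A; have Ob2 := AO b2A; have Ob := AO bA.
have evO p : ev x p \in O by apply/AO/evA.
have [qa qaA ta] := peval_taylor a0 Asub AC Ax yRA.
have Oqa := AO qaA; have [qb qbA tb] := peval_taylor b0 Asub AC Ax yRA.
have Oqb := AO qbA; pose b' :=
  ev x b1 + y * b2 - R * ev x b0^`() - y * R ^+ 2 * qb.
have Ob' : b' \in O.
  by rewrite /b'; in_subring Osub ltac:(apply: evO).
have bE' : b = ev w b0 + y * b' by rewrite /w tb bE /b'; ring.
have ub0 : unit_in O (ev w b0).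
  by apply: (@unit_mod_y _ b') => //; [apply/AO/evA | rewrite -bE'].
have b00 := unit_in_neq0 ub; have b000 := unit_in_neq0 ub0.
have aF : a = f * b ^+ 2 by rewrite fE divfK ?expf_neq0.
have dxa : dx a = dx f * b ^+ 2 by rewrite aF (der_mul_sqr _ _ Dx).
have dya : dy a = dy f * b ^+ 2 by rewrite aF (der_mul_sqr _ _ Dy).
have dxa' : dx a = ev x a0^`() + ev x a1^`() * y + y ^+ 2 * dx a2.
  by rewrite aE dx_expansion.
have dya' : dy a = ev x a1 + y ^+ 2 * dy a2 by rewrite aE dy_expansion.
pose s := e * b ^+ 2 - y * dy a2 + R * (ev x a1^`() + y * dx a2).
have Os : s \in O.
  by rewrite /s; in_subring Osub
    ltac:(first [apply: dxO | apply: dyO | apply: evO]).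
have a1E : ev x a1 = R * ev x a0^`() + y * s.
  have E : dy a - R * dx a = y * e * b ^+ 2 by rewrite dxa dya -fe; ring.
  have -> : ev x a1 = (dy a - R * dx a) - y ^+ 2 * dy a2 + R * dx a.
    by rewrite {1}dya'; ring.
  by rewrite {1}E dxa' /s; ring.
pose t' := s + a2 - R ^+ 2 * qa.
have Ot' : t' \in O by rewrite /t'; in_subring Osub ltac:(fail).
have aE' : a = ev w a0 + y ^+ 2 * t' by rewrite /w ta aE a1E /t'; ring.
exists a0, b0, (t' / b ^+ 2 - ev w a0 * b' ^+ 2 / (b ^+ 2 * ev w b0 ^+ 2)).
split=> //.
  have OVb := unit_in_inv ub; have OVb0 := unit_in_inv ub0.
  have Oev : ev w a0 \in O by apply/AO/evA.
  by rewrite [(b ^+ 2 * _)^-1]invfM -!exprVn; in_subring Osub ltac:(fail).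
rewrite fE aE'; apply: quot_mod_square => //.
rewrite {1}bE'; apply: (eq_char2 char2 (c := y * b' * ev w b0)); ring.
Qed.

(** Write the numerator of f as a0 + a1 y modulo y^2. The gluing conditions
    say that P a0' = x^2 a1 and that a1 P has derivative 0, first modulo y
    and then, as k[x] meets the ideal of y in 0, as polynomials. The
    numerator is then (p + q z) / P^2 with z = x^3 + yP, where q = a1 P and p
    = P^2 a0 - q x^3 have derivative 0. *)
Lemma glued_cusp_exists (Pp : {poly k}) f :
  (forall (q : {poly k}) e, e \in O -> ev x q = y * e -> q = 0) ->
  unit_in O (ev x Pp) -> glued_cusp x y dx dy O (ev x Pp) f ->
  exists p q r : {poly k}, exists t,
    [/\ p^`() = 0, q^`() = 0 & r^`() = 0] /\
    [/\ t \in O, unit_in O (ev x r) &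
    f = (ev x p + ev x q * (x ^+ 3 + y * ev x Pp)) / ev x r + y ^+ 2 * t].
Proof.
move=> ev_inj uP [Of [e Oe fe] [e' Oe' fe']].
have [a [b [aA bA ub fE]]] := square_denominator Of.
have [a0 [a1 [a2 a2A aE]]] := Aexp aA.
have [b0 [b1 [b2 b2A bE]]] := Aexp bA.
have Ox := AO Ax; have Oy := AO Ay.
have Oa2 := AO a2A; have Ob2 := AO b2A; have Ob := AO bA.
have evO p : ev x p \in O by apply/AO/peval_in.
pose b' := ev x b1 + y * b2.
have Ob' : b' \in O by rewrite /b'; in_subring Osub ltac:(apply: evO).
have bE' : b = ev x b0 + y * b' by rewrite bE /b'; ring.
have ub0 : unit_in O (ev x b0).
  by apply: (@unit_mod_y _ b') => //; rewrite -bE'.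
have b00 := unit_in_neq0 ub; have b000 := unit_in_neq0 ub0.
set P := ev x Pp in uP fe fe' *; have P0 := unit_in_neq0 uP.
have OP : P \in O by apply: evO.
pose h := cusp1 dy P f; have Ph : P * h = dy f by rewrite /h /cusp1 mulrC divfK.
have aF : a = f * b ^+ 2 by rewrite fE divfK ?expf_neq0.
have dxa : dx a = dx f * b ^+ 2 by rewrite aF (der_mul_sqr _ _ Dx).
have dya : dy a = dy f * b ^+ 2 by rewrite aF (der_mul_sqr _ _ Dy).
have dxa' : dx a = ev x a0^`() + ev x a1^`() * y + y ^+ 2 * dx a2.
  by rewrite aE dx_expansion.
have dya' : dy a = ev x a1 + y ^+ 2 * dy a2 by rewrite aE dy_expansion.
have dxdya : dx (dy a) = ev x a1^`() + y ^+ 2 * dx (dy a2).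
  rewrite dya' (derD Dx) dx_ev (derM Dx) (der_sqr char2 _ Dx).
  by rewrite mulr0 addr0.
have dxP : dx P = ev x Pp^`() by rewrite /P dx_ev.
have G1 : Pp * a0^`() - 'X^2 * a1 = 0.
  apply: (ev_inj _ (P * e * b ^+ 2 - P * ev x a1^`() - P * y * dx a2
                    + x ^+ 2 * y * dy a2)).
    by in_subring Osub ltac:(first [apply: dxO | apply: dyO | apply: evO]).
  rewrite !(pevalXn, pevalB, pevalM, pevalX) -/P.
  have -> : ev x a0^`() = dx a - ev x a1^`() * y - y ^+ 2 * dx a2.
    by rewrite dxa'; ring.
  have -> : ev x a1 = dy a - y ^+ 2 * dy a2 by rewrite dya'; ring.
  by rewrite dxa dya fe -/h -Ph; ring.
have G2 : a1^`() * Pp - a1 * Pp^`() = 0.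
  apply: (ev_inj _ (dx P * y * dy a2 - P * y * dx (dy a2) + P ^+ 2 * e' * b
    ^+ 2)).
    by in_subring Osub ltac:(first [apply: dxO | apply: dyO | apply: evO]).
  rewrite pevalB !pevalM -/P -dxP.
  have -> : ev x a1^`() = dx (dy a) - y ^+ 2 * dx (dy a2) by rewrite dxdya;
    ring.
  have -> : ev x a1 = dy a - y ^+ 2 * dy a2 by rewrite dya'; ring.
  rewrite dya -Ph (derM Dx) (derM Dx P) (der_sqr char2 _ Dx) -/h fe'; ring.
pose q := a1 * Pp; pose p := Pp ^+ 2 * a0 - q * ('X^2 * 'X).
have q' : q^`() = 0.
  rewrite /q derivM -[RHS]G2 -[LHS]addr0 -(pchar2 (- (a1 * Pp^`()))); ring.
have p' : p^`() = 0.
  rewrite /p derivB (derivM (Pp ^+ 2)) (derivM q) (derivM 'X^2) q' !deriv_sqr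
    derivX.
  transitivity (Pp * (Pp * a0^`() - 'X^2 * a1)); last by rewrite G1 mulr0.
  by rewrite /q; ring.
exists p, q, ((Pp * b0) ^+ 2), (a2 / b ^+ 2 -
  (ev x a0 + ev x a1 * y) * b' ^+ 2 / (b ^+ 2 * ev x b0 ^+ 2)).
rewrite deriv_sqr pevalXn pevalM -/P; split => //; split.
- have OVb := unit_in_inv ub; have OVb0 := unit_in_inv ub0.
  have := evO a0; have := evO a1 => *.
  by rewrite [(b ^+ 2 * _)^-1]invfM -!exprVn; in_subring Osub ltac:(fail).
- by rewrite expr2; do 2 apply: unit_inM => //.
have -> : (ev x p + ev x q * (x ^+ 3 + y * P)) / (P * ev x b0) ^+ 2 =
    (ev x a0 + ev x a1 * y) / ev x b0 ^+ 2.
  rewrite /p /q !(pevalXn, pevalB, pevalM, pevalX) -/P.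
  by field; rewrite P0 b000.
rewrite fE aE; apply: quot_mod_square => //.
by rewrite bE'; apply: (eq_char2 char2 (c := y * b' * ev x b0)); ring.
Qed.

End Gluing.

(** * Points and charts of the plane *)

Section ChangeOfChart.
Variables (k F : fieldType) (C : k -> F) (x y : F) (dx dy : F -> F).
Hypothesis xy : coordinates C x y dx dy.
Let Dx := dx_der xy.
Let Dy := dy_der xy.

Lemma derivation_comb a b : derivation C (fun f => a * dx f + b * dy f).
Proof.
split=> [c|f g|f g].
- by rewrite (derC Dx) (derC Dy) !mulr0 addr0.
- by rewrite (derD Dx) (derD Dy); ring.
- by rewrite (derM Dx) (derM Dy); ring.
Qed.

Lemma coordinates_at_u : x != 0 ->
  coordinates C x^-1 (y * x^-1)
    (fun f => - x ^+ 2 * dx f + - (x * y) * dy f)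
      (fun f => 0 * dx f + x * dy f).
Proof.
move=> x0; split.
- exact: derivation_comb.
- exact: derivation_comb.
- by rewrite (derV Dx) (derV Dy) (dx_x xy) (dy_x xy); field.
- rewrite !(derM Dx, derM Dy) (derV Dx) (derV Dy) (dx_x xy) (dx_y xy) (dy_x xy)
  (dy_y xy).
  by field.
- by rewrite (derV Dx) (derV Dy) (dx_x xy) (dy_x xy); field.
- rewrite !(derM Dx, derM Dy) (derV Dx) (derV Dy) (dx_x xy) (dx_y xy) (dy_x xy)
  (dy_y xy).
  by field.
move=> S SC Sx Sy SD SM SV; have Sx' : S x by rewrite -[x]invrK; apply: SV.
apply: (coord_gen xy) => //; have -> : y = (y * x^-1) * x by field.
exact: SM.
Qed.

Lemma coordinates_at_v : y != 0 ->
  coordinates C (x * y^-1) y^-1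
    (fun f => y * dx f + 0 * dy f)
      (fun f => - (x * y) * dx f + - y ^+ 2 * dy f).
Proof.
move=> y0; split.
- exact: derivation_comb.
- exact: derivation_comb.
- rewrite !(derM Dx, derM Dy) (derV Dx) (derV Dy) (dx_x xy) (dx_y xy) (dy_x xy)
  (dy_y xy).
  by field.
- by rewrite (derV Dx) (derV Dy) (dx_y xy) (dy_y xy); field.
- rewrite !(derM Dx, derM Dy) (derV Dx) (derV Dy) (dx_x xy) (dx_y xy) (dy_x xy)
  (dy_y xy).
  by field.
- by rewrite (derV Dx) (derV Dy) (dx_y xy) (dy_y xy); field.
move=> S SC Sx Sy SD SM SV; have Sy' : S y by rewrite -[y]invrK; apply: SV.
apply: (coord_gen xy) => //; have -> : x = (x * y^-1) * y by field.
exact: SM.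
Qed.
End ChangeOfChart.

Section Charts.
Variable k : fieldType.
Local Notation K := (K k).
Local Notation u := (@u k).
Local Notation v := (@v k).
Implicit Type c : chart.

Definition chx c : K :=
  match c with chU => u | chU' => u^-1 | chU'' => u * v^-1 end.
Definition chy c : K :=
  match c with chU => v | chU' => v * u^-1 | chU'' => v^-1 end.
Definition chdx c : K -> K := match c with
  | chU => @du k
  | chU' => fun f => - u ^+ 2 * du f + - (u * v) * dv f
  | chU'' => fun f => v * du f + 0 * dv f
  end.
Definition chdy c : K -> K := match c with
  | chU => @dv k
  | chU' => fun f => 0 * du f + u * dv f
  | chU'' => fun f => - (u * v) * du f + - v ^+ 2 * dv f
  end.

Lemma OX_chartE c : OX_chart c = alg [:: chx c; chy c].
Proof. by case: c. Qed.

Lemma chart_coordinates c : coordinates (@cst k) (chx c) (chy c) (chdx c)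
  (chdy c).
Proof.
have uv : coordinates (@cst k) u v (@du k) (@dv k).
  split; [exact: du_derivation | exact: dv_derivation | exact: du_u |
    exact: du_v
    | exact: dv_u | exact: dv_v | exact: K_ind].
case: c => //=; first by apply: coordinates_at_u => //; apply: u_neq0.
by apply: coordinates_at_v => //; apply: v_neq0.
Qed.

End Charts.

Section Points.
Variable k : fieldType.
Local Notation K := (K k).
Local Notation u := (@u k).
Local Notation v := (@v k).
Implicit Types (c : chart) (x : point k).

Lemma at_primeE x c p : at_prime x c p -> forall f, f \in OX x <->
  exists a b, [/\ a \in OX_chart c, b \in OX_chart c, b \notin p & f = a / b].
Proof.
by case=> pp E f; rewrite E; split=> [/asboolP|h]; last apply/asboolP.
Qed.

Lemma notin_prime x c p : at_prime x c p -> forall a, a \in OX_chart c ->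
  (a \notin p) = unit_in (OX x) a.
Proof.
move=> xp; have [pp _] := xp.
exact: (unit_in_local (OX_chart_subring k c) (prime_0 pp) (prime_lin pp)
  (at_primeE xp)).
Qed.

Lemma in_prime x c p : at_prime x c p -> forall a, a \in OX_chart c ->
  (a \in p) = ~~ unit_in (OX x) a.
Proof. by move=> xp a ac; rewrite -(notin_prime xp ac) negbK. Qed.

Lemma OX_nonunitD x f g : f \in OX x -> g \in OX x ->
  unit_in (OX x) (f + g) -> unit_in (OX x) f || unit_in (OX x) g.
Proof.
have [c [p xp]] := pointP x; have [pp _] := xp.
exact: (nonunitD (OX_subring x) (OX_chart_subring k c) (prime_0 pp) (prime_1 pp)
   (prime_lin pp) (at_primeE xp)).
Qed.

(** Each coordinate of one chart is a product of coordinates of another one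
    and of inverses of such coordinates. *)
Lemma chart_transition (L : K -> Prop) (O : {pred K}) c c0 :
  (forall f g, L f -> L g -> L (f * g)) ->
  (forall f, L f^-1 -> f \in O -> L f) ->
  L (chx k c) -> L (chy k c) -> chx k c0 \in O -> chy k c0 \in O ->
  L (chx k c0) /\ L (chy k c0).
Proof.
move=> LM LI; have u0 := u_neq0 k; have v0 := v_neq0 k.
have LV f : L f -> f^-1 \in O -> L f^-1 by move=> h; apply: LI; rewrite invrK.
case: c c0 => [] [] /= Lx Ly Ox Oy; split; try assumption.
- exact: LV Lx Ox.
- by apply: LM Ly _; apply: LV Lx Ox.
- by apply: LM Lx _; apply: LV Ly Oy.
- exact: LV Ly Oy.
- exact: LI Lx Ox.
- by rewrite -[v](divfK u0); apply: LM Ly _; apply: LI Lx Ox.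
- by apply: (LI) Ox; rewrite invfM invrK mulrC.
- rewrite -[v^-1](mulKf u0); apply: LM Lx _.
  by apply: (LI) Ox; rewrite invfM invrK mulrC.
- rewrite -[u](divfK v0); apply: LM Lx _; exact: LI Ly Oy.
- exact: LI Ly Oy.
- rewrite -[u^-1](mulKf v0); apply: LM Ly _.
  by apply: (LI) Oy; rewrite invfM invrK mulrC.
- by apply: (LI) Oy; rewrite invfM invrK mulrC.
Qed.

Lemma chx_chart c : chx k c \in OX_chart c.
Proof. by rewrite OX_chartE; apply: alg_gen; rewrite inE eqxx. Qed.

Lemma chy_chart c : chy k c \in OX_chart c.
Proof. by rewrite OX_chartE; apply: alg_gen; rewrite !inE eqxx orbT. Qed.

Lemma cst_chart c a : cst a \in OX_chart (k:=k) c.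
Proof. by rewrite OX_chartE; apply: alg_cst. Qed.

Lemma chart_ind c (S : K -> Prop) :
  (forall a, S (cst a)) -> S (chx k c) -> S (chy k c) ->
  (forall f g, S f -> S g -> S (f + g)) ->
  (forall f g, S f -> S g -> S (f * g)) -> forall f, f \in OX_chart c -> S f.
Proof.
move=> SC Sx Sy SD SM f; rewrite OX_chartE; move: f; apply: alg_ind => // z.
by rewrite !inE => /orP [] /eqP ->.
Qed.

Definition in_chart x c : Prop := chx k c \in OX x /\ chy k c \in OX x.

Lemma at_in_chart x c p : at_prime x c p -> in_chart x c.
Proof.
by move=> xp; split; apply: (OX_at xp); rewrite ?chx_chart ?chy_chart.
Qed.

(** If the coordinates of a chart are regular at x, then x lies in this
    chart. The fractions of the chart whose denominators are units at x
    contain the coordinates of any chart containing x, hence everything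
    regular at x. *)
Lemma chart_fracs x c : in_chart x c ->
  forall f, f \in OX x -> fracs (OX x) (OX_chart c) f.
Proof.
move=> [Ox Oy]; have Os := OX_subring x; have As := OX_chart_subring k c.
have gen f := @fracs_gen _ _ Os _ As f.
have LM f g := @fracsM _ _ Os _ As f g; have LV f :=
  @fracsV _ _ Os (OX_chart c) f.
have LI f := @fracs_inv _ _ Os (OX_chart c) f.
have [c0 [p0 xp0]] := pointP x; have [Ox0 Oy0] := at_in_chart xp0.
have [Lx Ly] := chart_transition LM LI (gen _ (chx_chart c))
  (gen _ (chy_chart c)) Ox0 Oy0.
have A0L : forall a, a \in OX_chart c0 -> fracs (OX x) (OX_chart c) a.
  apply: chart_ind => // [a|f g]; first by apply: gen; apply: cst_chart.
  exact: (@fracsD _ _ Os _ As).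
move=> f /(at_primeE xp0) [a [b [ac bc bp ->]]].
have ub : unit_in (OX x) b by rewrite -(notin_prime xp0).
by apply: LM; [exact: A0L | apply: LV; [exact: A0L | exact: unit_in_inv ub]].
Qed.

Lemma chart_sub x c : in_chart x c -> {subset OX_chart c <= OX x}.
Proof.
move=> [Ox Oy]; apply: chart_ind => // [a|f g|f g].
- have [c0 [p0 xp0]] := pointP x; apply: (OX_at xp0); exact: cst_chart.
- by move=> fO gO; apply: (subring_D (OX_subring x)).
- by move=> fO gO; apply: (subring_M (OX_subring x)).
Qed.

Lemma in_chart_at x c : in_chart x c -> exists p, at_prime x c p.
Proof.
move=> xc; have Os := OX_subring x; have As := OX_chart_subring k c.
exists (nonunits (OX x) (OX_chart c)).
have [h1 h2 h3 h4 h5] := nonunits_prime Os As (chart_sub xc) (@OX_nonunitD x).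
split; first by split.
have E := nonunits_loc Os (chart_sub xc) (chart_fracs xc).
move=> f; apply/idP/asboolP; first by move/E.
by move=> h; apply/E.
Qed.

Lemma der_OX x c D : in_chart x c -> derivation (@cst k) D ->
  D (chx k c) \in OX x -> D (chy k c) \in OX x ->
  forall f, f \in OX x -> D f \in OX x.
Proof.
move=> xc DD Dx Dy f fO; have Os := OX_subring x.
have AO := chart_sub xc; have [Ox Oy] := xc.
have DA : forall a, a \in OX_chart c -> D a \in OX x /\ a \in OX x.
  apply: chart_ind => // [a|a b [Da aO] [Db bO]|a b [Da aO] [Db bO]].
  - by rewrite (derC DD); split;
    [exact: subring_0 | apply: AO; exact: cst_chart].
  - by rewrite (derD DD); split; apply: (subring_D Os).
  - rewrite (derM DD); split; last by apply: (subring_M Os).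
    by apply: (subring_D Os); apply: (subring_M Os).
have [a [b [ac bc ub fE]]] := chart_fracs xc fO.
have [Da aO] := DA _ ac; have [Db bO] := DA _ bc.
rewrite fE (der_div DD); last exact: unit_in_neq0 ub.
rewrite -exprVn; have bV := unit_in_inv ub.
apply: (subring_M Os); last exact: (subring_X Os).
by apply: (subring_D Os); [|apply: (subring_N Os)]; apply: (subring_M Os).
Qed.

Lemma fracs_generic c f : fracs predT (OX_chart (k:=k) c) f.
Proof.
have As := OX_chart_subring k c.
have Ts : subring_closed (predT : {pred K}) by [].
move: f; apply: (coord_gen (chart_coordinates k c)) => [a||||f g|f].
- by apply: (fracs_gen Ts As); exact: cst_chart.
- by apply: (fracs_gen Ts As); exact: chx_chart.
- by apply: (fracs_gen Ts As); exact: chy_chart.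
- exact: fracsD.
- exact: fracsM.
- by move=> h; apply: (fracsV Ts).
Qed.

Definition zero_ideal : {pred K} := fun f => f == 0.

Lemma in_zero_ideal f : (f \in zero_ideal) = (f == 0). Proof. by []. Qed.

Lemma zero_ideal_prime c : prime_ideal (OX_chart (k:=k) c) zero_ideal.
Proof.
split.
- move=> f; rewrite in_zero_ideal => /eqP ->.
  exact: (subring_0 (OX_chart_subring k c)).
- by rewrite in_zero_ideal.
- by rewrite in_zero_ideal oner_eq0.
- move=> a f g _; rewrite !in_zero_ideal => /eqP -> /eqP ->.
  by rewrite mulr0 addr0.
- by move=> a b _ _; rewrite !in_zero_ideal mulf_eq0.
Qed.

Lemma zero_ideal_loc c : predT =i loc (OX_chart (k:=k) c) zero_ideal.
Proof.
move=> f; apply/esym/asboolP; have [a [b [ac bc ub ->]]] := fracs_generic c f.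
by exists a, b; split => //; exact: (unit_in_neq0 ub).
Qed.

Lemma generic_pointP : exists c p, prime_ideal (OX_chart (k:=k) c) p /\
  predT =i loc (OX_chart c) p.
Proof.
by exists chU, zero_ideal; split;
  [exact: zero_ideal_prime | exact: zero_ideal_loc].
Qed.

Definition generic_point : point k := Point generic_pointP.

Lemma generic_at c : at_prime generic_point c zero_ideal.
Proof. by split; [exact: zero_ideal_prime | exact: zero_ideal_loc]. Qed.

(** A basic open set is given by a function outside a prime, so by a nonzero
    one, and a nonzero function does not vanish at the generic point. *)
Lemma generic_in_open (W : point k -> Prop) : openX W -> (exists x, W x) ->
  W generic_point.
Proof.
move=> Wo [x Wx]; have [c [p xp]] := pointP x.
have [f [fc fp h]] := Wo x c p Wx xp; apply: (h _ _ (generic_at c)).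
by rewrite in_zero_ideal; apply: contraNneq fp => ->; case: xp => pp _;
  apply: prime_0 pp.
Qed.

Definition regular_locus (s : seq K) (x : point k) : Prop :=
  forall f, f \in s -> f \in OX x.

Lemma regular_locus_open s : openX (regular_locus s).
Proof.
move=> x c p Wx xp; have [pp _] := xp.
have [S1 SB SM] := OX_chart_subring k c.
elim: s Wx => [|g s IH] Wx.
  by exists 1; split => //; exact: prime_1 pp.
have [f [fc fp h]] := IH (fun z zs => Wx z (mem_behead (s := g :: s) zs)).
have [a [b [ac bc bp gE]]] := (at_primeE xp g).1 (Wx _ (mem_head _ _)).
exists (b * f); split; first exact: SM.
  by apply/negP => /(prime_mul pp bc fc); rewrite (negbTE bp) (negbTE fp).
move=> y q yq bfq z; have [pq _] := yq.
rewrite inE => /orP [/eqP ->|zs].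
  apply/(at_primeE yq); exists a, b; split => //; apply: contra bfq => bq.
  rewrite -[b * f]addr0 mulrC; apply: (prime_lin pq) => //; exact: prime_0 pq.
apply: (h y q yq) zs; apply: contra bfq => fq.
rewrite -[b * f]addr0; apply: (prime_lin pq) => //; exact: prime_0 pq.
Qed.

End Points.

(** * The local rings of Y *)

Lemma cubic_inv (F : fieldType) (a0 a1 a2 a3 u : F) : u != 0 ->
  a0 * u ^+ 0 + (a1 * u ^+ 1 + (a2 * u ^+ 2 + (a3 * u ^+ 3 + 0))) =
  u ^+ 3 * (a0 * u^-1 ^+ 3 + a1 * u^-1 ^+ 2 + a2 * u^-1 + a3).
Proof. by move=> u0; field. Qed.

Lemma par_at_infinity (F : fieldType) (u v R : F) : u != 0 ->
  u^-1 + v * u ^- 4 * (u ^+ 3 * R) = u^-1 + v * u^-1 * R.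
Proof. by move=> u0; field. Qed.

(** On the overlap of the two charts, the local parameter of C on U' is (u^3
    + vP) / (u^2)^2. Hence the two descriptions of the ring of C agree. *)
Lemma par_change (F : fieldType) (u v R : F) : u != 0 ->
  u^-1 + v * u^-1 * R = (u ^+ 3 + v * (u ^+ 3 * R)) * (u ^+ 2)^-1 ^+ 2.
Proof. by move=> u0; field. Qed.

Lemma par_change_ideal (F : fieldType) (u v t : F) :
  (v * u^-1) ^+ 2 * t = v ^+ 2 * (u^-1 ^+ 2 * t).
Proof. by rewrite exprMn -!mulrA. Qed.

(** The gluing condition of U' follows from the one of U. The left-hand side
    is the derivation d/dr - R d/ds of U', expressed in the coordinates of U,
    with R u^3 = P; the right-hand side is a multiple of r = v/u. *)
Lemma glued_change (F : fieldType) (u v R h e du dv : F) :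
  (forall a : F, a + a = 0) -> u != 0 ->
  du = u ^+ 2 * h + v * e -> dv = u ^+ 3 * R * h ->
  0 * du + u * dv - R * (- u ^+ 2 * du + - (u * v) * dv) =
  v * u^-1 * (u ^+ 3 * R * e + R * u ^+ 2 * (u ^+ 3 * R) * h).
Proof.
move=> char2 u0 -> ->; apply: (eq_char2 char2 (c := u ^+ 4 * R * h)).
by field.
Qed.

Lemma expand_mul (F : fieldType) (y a0 a1 a2 b0 b1 b2 : F) :
  (a0 + a1 * y + y ^+ 2 * a2) * (b0 + b1 * y + y ^+ 2 * b2) =
  a0 * b0 + (a0 * b1 + a1 * b0) * y +
  y ^+ 2 * (a1 * b1 + a2 * (b0 + b1 * y + y ^+ 2 * b2) + b2 * (a0 + a1 * y)).
Proof. by ring. Qed.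

Lemma expand_add (F : fieldType) (y a0 a1 a2 b0 b1 b2 : F) :
  (a0 + a1 * y + y ^+ 2 * a2) + (b0 + b1 * y + y ^+ 2 * b2) =
  (a0 + b0) + (a1 + b1) * y + y ^+ 2 * (a2 + b2).
Proof. by ring. Qed.

Section LocalRings.
Variables (k : fieldType) (P : {poly_4 k}).
Hypothesis kchar2 : forall a : k, a + a = 0.
Local Notation K := (K k).
Local Notation u := (@u k).
Local Notation v := (@v k).
Local Notation Pp := (P : {poly k}).
Local Notation Pu := (evalu Pp).
Local Notation ev := (peval (@cst k)).
Implicit Types (x : point k).

Let u0 := u_neq0 k.
Let v0 := v_neq0 k.

Lemma K_char2 (a : K) : a + a = 0.
Proof.
by rewrite -[a]mulr1 -mulrDr -(rmorph1 (@cst k)) -rmorphD kchar2 rmorph0 mulr0.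
Qed.

Lemma chart_expand c (a : K) : a \in OX_chart c -> exists a0 a1 : {poly k},
  exists2 a2, a2 \in OX_chart c &
  a = ev (chx k c) a0 + ev (chx k c) a1 * chy k c + chy k c ^+ 2 * a2.
Proof.
have As := OX_chart_subring k c; have A0 := subring_0 As; have A1 :=
  subring_1 As.
have AD f g := @subring_D _ _ As f g; have AM f g := @subring_M _ _ As f g.
have Ax := chx_chart k c; have Ay := chy_chart k c.
have Aev p : ev (chx k c) p \in OX_chart c.
  by apply: (peval_in _ As); [move=> b; exact: cst_chart | exact: Ax].
move: a; apply: chart_ind => [b|||a b|a b].
- exists b%:P, 0, 0; first exact: A0.
  by rewrite pevalC peval0 mul0r mulr0 !addr0.
- exists 'X, 0, 0; first exact: A0.
  by rewrite pevalX peval0 mul0r mulr0 !addr0.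
- exists 0, 1, 0; first exact: A0.
  by rewrite peval0 -polyC1 pevalC rmorph1 mul1r mulr0 add0r addr0.
- move=> [a0 [a1 [a2 Aa2 ->]]] [b0 [b1 [b2 Ab2 ->]]].
  exists (a0 + b0), (a1 + b1), (a2 + b2); first exact: AD.
  by rewrite expand_add !pevalD.
move=> [a0 [a1 [a2 Aa2 ->]]] [b0 [b1 [b2 Ab2 ->]]].
exists (a0 * b0), (a0 * b1 + a1 * b0); eexists; last first.
  by rewrite expand_mul !(pevalD, pevalM).
by in_subring As ltac:(apply: Aev).
Qed.

Lemma chdxO x c : in_chart x c -> forall f, f \in OX x -> chdx c f \in OX x.
Proof.
move=> xc; have xy := chart_coordinates k c; apply: (der_OX xc (dx_der xy)).
  by rewrite (dx_x xy); apply: (subring_1 (OX_subring x)).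
by rewrite (dx_y xy); apply: (subring_0 (OX_subring x)).
Qed.

Lemma chdyO x c : in_chart x c -> forall f, f \in OX x -> chdy c f \in OX x.
Proof.
move=> xc; have xy := chart_coordinates k c; apply: (der_OX xc (dy_der xy)).
  by rewrite (dy_x xy); apply: (subring_0 (OX_subring x)).
by rewrite (dy_y xy); apply: (subring_1 (OX_subring x)).
Qed.

(** $u^{-3} P$ as a polynomial in $u^{-1}$. *)
Definition revP : {poly k} :=
  (Pp`_0)%:P * 'X ^+ 3 + (Pp`_1)%:P * 'X ^+ 2 + (Pp`_2)%:P * 'X + (Pp`_3)%:P.
Definition revPu : K := ev u^-1 revP.
Local Notation R := revPu.

Lemma revPuE : Pu = u ^+ 3 * R.
Proof.
rewrite PuE !big_ord_recl big_ord0 /= (cubic_inv _ _ _ _ u0).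
by rewrite /revPu /revP !(pevalXn, pevalD, pevalM, pevalC, pevalX).
Qed.

Lemma revPu_chart : R \in OX_chart chU'.
Proof.
apply: (peval_in _ (OX_chart_subring k chU')); last exact: (chx_chart k chU').
by move=> c; exact: cst_chart.
Qed.

Lemma chdy_revPu : chdy chU' R = 0.
Proof.
have xy := chart_coordinates k chU'.
by rewrite /revPu (der_peval _ _ (dy_der xy)) (dy_x xy) mulr0.
Qed.

Lemma dv_Pu : dv Pu = 0.
Proof.
by rewrite evaluE (der_peval _ _ (dv_derivation k)) dv_u mulr0.
Qed.

Local Notation s := (chx k chU').
Local Notation r := (chy k chU').
Definition glued_smooth_at x : K -> Prop :=
  glued_smooth r (chdx chU') (chdy chU') (OX x) R.

Lemma OC_chartU' : OC_chart P chU' = alg [:: s + r * R].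
Proof. by rewrite /OC_chart revPuE (par_at_infinity _ _ u0). Qed.

Lemma glued_smooth_split x p f : at_prime x chU' p -> r \in p ->
  glued_smooth_at x f ->
  exists g t, [/\ g \in loc (OC_chart P chU') p, t \in OX x & f =
    g + r ^+ 2 * t].
Proof.
move=> xp rp; have xc := at_in_chart xp.
rewrite (in_prime xp (chy_chart k chU')) in rp.
move=> /(glued_smooth_exists kchar2 (chart_coordinates k chU')
  (OX_chart_subring k chU') (OX_subring x) (cst_chart chU') (chx_chart k chU')
  (chy_chart k chU') (chart_sub xc) (chart_fracs xc) (@chart_expand chU') rp
  (@OX_nonunitD _ x) (chdxO xc) (chdyO xc) revPu_chart chdy_revPu).
move=> [a [b [t [tO ub fE]]]].
have evC q : ev (s + r * R) q \in OC_chart P chU'.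
  apply: (peval_in _ (OC_chart_subring P chU')).
    by move=> c; rewrite OC_chartU'; apply: alg_cst.
  by rewrite OC_chartU'; apply: alg_gen; rewrite inE eqxx.
exists (ev (s + r * R) a / ev (s + r * R) b ^+ 2), t; split => //.
have b2C : ev (s + r * R) b ^+ 2 \in OC_chart P chU'.
  exact: (subring_X (OC_chart_subring P chU')).
apply/asboolP; exists (ev (s + r * R) a), (ev (s + r * R) b ^+ 2); split => //.
rewrite (notin_prime xp (OC_chartW b2C)).
exact: (unit_inM (OX_subring x) ub ub).
Qed.

Lemma glued_smooth_of_split x p g t : at_prime x chU' p ->
  g \in loc (OC_chart P chU') p -> t \in OX x ->
    glued_smooth_at x (g + r ^+ 2 * t).
Proof.
move=> xp /asboolP [a [b [aC bC bp ->]]] tO; have xc := at_in_chart xp.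
have xy := chart_coordinates k chU'; have Os := OX_subring x.
have AO := chart_sub xc; have [Os' Or] := xc; have OR := AO _ revPu_chart.
have SD f h := @glued_smoothD _ _ _ _ _ _ _ xy _ Os R f h.
have SM f h := @glued_smoothM _ _ _ _ _ _ _ xy _ Os R f h.
have SC : forall f, f \in OC_chart P chU' -> glued_smooth_at x f.
  rewrite OC_chartU'; apply: alg_ind => [c|f|f h|f h].
  - by apply: (glued_smooth_const xy Os); apply: AO; exact: cst_chart.
  - rewrite inE => /eqP ->; apply: (glued_smooth_par xy Os) => //.
      exact: chdxO.
    exact: chdy_revPu.
  - exact: SD.
  - exact: SM.
have ub : unit_in (OX x) b by rewrite -(notin_prime xp (OC_chartW bC)).
apply: SD; last first.
  exact: (glued_smooth_ideal K_char2 xy Os (chdxO xc) (chdyO xc) Or OR tO).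
apply: SM; first exact: SC.
apply: (glued_smoothV K_char2 xy Os); first exact: SC.
exact: unit_in_inv ub.
Qed.

(** A point of U' on A may also lie in U, and the germs of O_Y must come from
    C in both charts. The second condition follows from the first one by
    par_change, since u is a unit at such a point. *)
Lemma OY_in_U' x f : in_chart x chU' -> f \in OY_pred P x <->
  glued_smooth_at x f.
Proof.
move=> xc; have Os := OX_subring x; split.
  move=> /andP [fO /asboolP h]; have [rU|rU] := boolP (unit_in (OX x) r).
    split => //; exists (r^-1 * (chdy chU' f - R * chdx chU' f)).
      apply: (subring_M Os); first exact: unit_in_inv rU.
      apply: (subring_D Os); first exact: chdyO.
      apply/(subring_N Os)/(subring_M Os); last exact: chdxO.
      exact: (chart_sub xc revPu_chart).
    by rewrite (mulVKf (unit_in_neq0 rU)).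
  have [p xp] := in_chart_at xc.
  have rp : r \in p by rewrite (in_prime xp (chy_chart k chU')).
  have [g [t [gC tO ->]]] := h _ _ xp rp; exact: glued_smooth_of_split xp gC tO.
move=> fS; have [fO _] := fS; apply/andP; split => //; apply/asboolP => c p xp.
case: c xp => xp ep; last by have [/prime_1] := xp; rewrite ep.
  have [p' xp'] := in_chart_at xc; have xU := at_in_chart xp.
  have [Ou Ov] := xU; have [Os' _] := xc.
  have uU : unit_in (OX x) u by rewrite /unit_in u0.
  have rp' : r \in p'.
    rewrite (in_prime xp' (chy_chart k chU')).
    move: ep; rewrite (in_prime xp (chy_chart k chU)); apply: contra => rU.
    by rewrite -[chy k chU](divfK u0); apply: (unit_inM Os).
  have [g [t [/asboolP [a [b [aC bC bp ->]]] tO ->]]] :=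
    glued_smooth_split xp' rp' fS.
  have OCs := OC_chart_subring P chU.
  pose L := fracs (OX x) (OC_chart P chU).
  have uuL : L (u ^+ 2).
    by apply: (fracs_gen Os OCs); apply: alg_gen; rewrite inE eqxx.
  have zL : L (u ^+ 3 + v * Pu).
    by apply: (fracs_gen Os OCs); apply: alg_gen; rewrite !inE eqxx orbT.
  have uuVL : L (u ^+ 2)^-1.
    apply: (fracsV Os uuL); rewrite -exprVn; exact: (subring_X Os).
  have LM f1 f2 := @fracsM _ _ Os _ OCs f1 f2.
  have CL : forall f1, f1 \in OC_chart P chU' -> L f1.
    rewrite OC_chartU'; apply: alg_ind => [c|f1|f1 f2|f1 f2].
    - by apply: (fracs_gen Os OCs); apply: alg_cst.
    - rewrite inE => /eqP ->; rewrite (par_change _ _ u0) -revPuE.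
      by apply: (LM _ _ zL); rewrite expr2; apply: (LM).
    - exact: (@fracsD _ _ Os _ OCs).
    - exact: LM.
  have ub : unit_in (OX x) b by rewrite -(notin_prime xp' (OC_chartW bC)).
  have [a' [b' [a'C b'C ub' abE]]] : L (a / b).
    by apply: LM; [exact: CL | apply: (fracsV Os (CL _ bC));
      exact: unit_in_inv ub].
  exists (a / b), (u^-1 ^+ 2 * t); split.
  - apply/asboolP; exists a', b'; split => //.
    by rewrite (notin_prime xp (OC_chartW b'C)).
  - by apply: (subring_M Os) => //; apply: (subring_X Os).
  - by rewrite -par_change_ideal.
exact: glued_smooth_split xp ep fS.
Qed.

Definition glued_cusp_at x : K -> Prop :=
  glued_cusp u v (@du k) (@dv k) (OX x) Pu.

(** In characteristic 2 the coefficient of degree i - 1 of the derivative is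
    the coefficient of degree i when i is odd. *)
Lemma odd_coef_deriv0 (q : {poly k}) i : q^`() = 0 -> odd i -> q`_i = 0.
Proof.
case: i => // i q0 io; have := congr1 (fun p : {poly k} => p`_i) q0.
rewrite coef_deriv coef0 -[i.+1]odd_double_half io -mul2n mulnC.
by rewrite mulrnDr mulr1n mulnC mulrnA mulr2n kchar2 mul0rn addr0.
Qed.

Lemma peval_deriv0 (q : {poly k}) : q^`() = 0 -> ev u q \in OC_chart P chU.
Proof.
move=> q0; have Cs := OC_chart_subring P chU.
rewrite /peval horner_coef.
have CD : forall f g, f \in OC_chart P chU -> g \in OC_chart P chU ->
  f + g \in OC_chart P chU by move=> f g; apply: subring_D.
apply: (big_ind (fun f => f \in OC_chart P chU)) => [|f g|i _].
- exact: subring_0.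
- exact: CD.
rewrite coef_map /=; have [io|ie] := boolP (odd i).
  by rewrite odd_coef_deriv0 // rmorph0 mul0r; apply: subring_0.
apply: (subring_M Cs); first exact: alg_cst.
rewrite -[nat_of_ord i]odd_double_half (negbTE ie) add0n -mul2n exprM.
by apply: (subring_X Cs); apply: alg_gen; rewrite inE eqxx.
Qed.

(** The ring k[u] embeds in k[u, v] / (v), and the denominators at a point of
    A do not vanish identically on A. *)
Lemma peval_notin_ideal x p q e : at_prime x chU p -> v \in p -> e \in OX x ->
  ev u q = v * e -> q = 0.
Proof.
move=> xp vp /(at_primeE xp) [n [d [/algUP [N ->] /algUP [D ->] dp ->]]] E.
have [pp _] := xp; have D0 : D != 0.
  by apply: contraNneq dp => ->; rewrite tofrac0; apply: prime_0 pp.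
have tD0 : tofrac D != 0 :> K by rewrite tofrac_eq0.
have {}E : q%:P * D = 'X * N.
  apply/eqP; rewrite -tofrac_eq !tofracM -/(evalu q) evaluE E.
  by rewrite -mulrA (divfK tD0).
have : q * D.[0] = 0 by have := congr1 (horner^~ 0) E; rewrite !hornerE.
move/eqP; rewrite mulf_eq0 => /orP [/eqP //|/factor_theorem [D' D'E]].
case/negP: dp; rewrite D'E subr0 tofracM -/v -[_ * _]addr0.
apply: (prime_lin pp) => //; last exact: prime_0 pp.
by apply/algUP; exists D'.
Qed.

Lemma glued_cusp_split x p f : at_prime x chU p -> v \in p ->
  unit_in (OX x) Pu -> glued_cusp_at x f ->
  exists g t, [/\ g \in loc (OC_chart P chU) p, t \in OX x & f =
    g + v ^+ 2 * t].
Proof.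
move=> xp vp uP; have xc := at_in_chart xp.
have inj q e : e \in OX x -> ev u q = v * e -> q = 0.
  exact: peval_notin_ideal xp vp.
rewrite (in_prime xp (chy_chart k chU)) in vp.
rewrite /glued_cusp_at evaluE; rewrite evaluE in uP.
move=> /(glued_cusp_exists kchar2 (chart_coordinates k chU)
  (OX_chart_subring k chU) (OX_subring x) (cst_chart chU) (chx_chart k chU)
  (chy_chart k chU) (chart_sub xc) (chart_fracs xc) (@chart_expand chU) vp
  (@OX_nonunitD _ x) (chdxO xc) (chdyO xc) inj uP).
move=> [a [b [d [t [[a0 b0 d0] [tO ud fE]]]]]].
have Cs := OC_chart_subring P chU.
have zC : u ^+ 3 + v * ev u Pp \in OC_chart P chU.
  by rewrite -evaluE; apply: alg_gen; rewrite !inE eqxx orbT.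
have aC := peval_deriv0 a0; have bC := peval_deriv0 b0; have dC :=
  peval_deriv0 d0.
exists ((ev u a + ev u b * (u ^+ 3 + v * ev u Pp)) / ev u d), t; split => //.
apply/asboolP; exists (ev u a + ev u b * (u ^+ 3 + v * ev u Pp)), (ev u d).
split => //; last by rewrite (notin_prime xp (OC_chartW dC)).
by apply: (subring_D Cs aC); apply: (subring_M Cs).
Qed.

Lemma Pu_in x : in_chart x chU -> Pu \in OX x.
Proof.
move=> xc; apply: (chart_sub xc); rewrite evaluE.
apply: (peval_in _ (OX_chart_subring k chU)); last exact: (chx_chart k chU).
by move=> c; apply: cst_chart.
Qed.

Lemma glued_cusp_of_split x p g t : at_prime x chU p -> unit_in (OX x) Pu ->
  g \in loc (OC_chart P chU) p -> t \in OX x ->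
    glued_cusp_at x (g + v ^+ 2 * t).
Proof.
move=> xp uP /asboolP [a [b [aC bC bp ->]]] tO; have xc := at_in_chart xp.
have xy := chart_coordinates k chU; have Os := OX_subring x.
have AO := chart_sub xc; have [Ou Ov] := xc.
have P0 := unit_in_neq0 uP; have OPV := unit_in_inv uP; have OP := Pu_in xc.
have dO := chdxO xc; have dO' := chdyO xc.
have SM f h := @glued_cuspM _ _ _ _ _ _ _ K_char2 xy _ Os dO' _ OPV P0 f h.
have SD f h := @glued_cuspD _ _ _ _ _ _ _ xy _ Os Pu f h.
have SC : forall f, f \in OC_chart P chU -> glued_cusp_at x f.
  apply: alg_ind => [c|f|f h|f h].
  - by apply: (glued_cusp_const xy Os); apply: AO; exact: cst_chart.
  - rewrite !inE => /orP [] /eqP ->;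
    first exact: (glued_cusp_sqr K_char2 xy Os).
    exact: (glued_cusp_z K_char2 xy Os dO Ou Ov OP P0 dv_Pu).
  - exact: SD.
  - exact: SM.
have ub : unit_in (OX x) b by rewrite -(notin_prime xp (OC_chartW bC)).
apply: SD; last first.
  exact: (glued_cusp_ideal K_char2 xy Os dO dO' Ou Ov OPV P0 tO).
apply: SM; first exact: SC.
apply: (glued_cuspV K_char2 xy Os dO' OPV P0); first exact: SC.
exact: unit_in_inv ub.
Qed.

(** At a point that also lies in U', the condition in that chart follows by
    glued_change. *)
Lemma OY_in_U x f : in_chart x chU -> unit_in (OX x) Pu ->
  f \in OY_pred P x <-> glued_cusp_at x f.
Proof.
move=> xc uP; have Os := OX_subring x; have [Ou Ov] := xc.
have P0 := unit_in_neq0 uP; have OPV := unit_in_inv uP; have OP := Pu_in xc.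
split.
  move=> /andP [fO /asboolP h]; have [vU|vU] := boolP (unit_in (OX x) v).
    have hO : cusp1 (@dv k) Pu f \in OX x.
      by apply: (subring_M Os) => //; apply: (chdyO xc).
    have vV := unit_in_inv vU; split => //.
      exists (v^-1 * (du f - u ^+ 2 * cusp1 (@dv k) Pu f)).
        apply: (subring_M Os vV); apply: (subring_D Os);
          first exact: (chdxO xc).
        by apply/(subring_N Os)/(subring_M Os) => //; apply: (subring_X Os).
      by rewrite (mulVKf v0) addrC subrK.
    exists (v^-1 * du (cusp1 (@dv k) Pu f)); last by rewrite (mulVKf v0).
    by apply: (subring_M Os vV); apply: (chdxO xc).
  have [p xp] := in_chart_at xc.
  have vp : v \in p by rewrite (in_prime xp (chy_chart k chU)).
  have [g [t [gC tO ->]]] := h _ _ xp vp;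
    exact: glued_cusp_of_split xp uP gC tO.
move=> fS; have [fO [e eO fe] _] := fS; apply/andP; split => //.
apply/asboolP => c p xp; case: c xp => xp ep; last by have [/prime_1] := xp;
  rewrite ep.
  exact: glued_cusp_split xp ep uP fS.
apply: (glued_smooth_split xp ep); split => //.
have xc' := at_in_chart xp; have [Os' _] := xc'.
have OR := chart_sub xc' revPu_chart.
exists (u ^+ 3 * R * e + R * u ^+ 2 * (u ^+ 3 * R) * cusp1 (@dv k) Pu f).
  rewrite -revPuE; have hO : cusp1 (@dv k) Pu f \in OX x.
    by apply: (subring_M Os) => //; apply: (chdyO xc).
  apply: (subring_D Os); first exact: (subring_M Os).
  do 2 apply: (subring_M Os) => //; apply: (subring_M Os) => //.
  exact: (subring_X Os).
apply: (glued_change K_char2 u0 fe).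
by rewrite -revPuE /cusp1 mulrC (divfK P0).
Qed.

Lemma OY_in_U'' x f : in_chart x chU'' -> f \in OY_pred P x <-> f \in OX x.
Proof.
move=> xc; have [Ox Oy] := xc; split=> [/andP []//|fO]; apply/andP; split => //.
apply/asboolP => c p xp; case: c xp => xp ep.
- move: ep; rewrite (in_prime xp (chy_chart k chU)) /unit_in => /negP [].
  by apply/andP; split; [exact: v0 | exact: Oy].
- move: ep; rewrite (in_prime xp (chy_chart k chU')) /unit_in => /negP [].
  apply/andP; split; first by rewrite mulf_neq0 ?invr_eq0;
    [|exact: v0|exact: u0].
  by rewrite /= invfM invrK mulrC.
by have [/prime_1] := xp; rewrite ep.
Qed.

End LocalRings.

(** * A criterion for freeness *)

Section FreeCriterion.
Variables (k : fieldType) (P : {poly_4 k}).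
Local Notation K := (K k).

Section Stalk.
Variable x : point k.
Local Notation d := (kaehler_d (@OY_cst k P x)).
Local Notation OYx := (OY P x).

Lemma germK f : f \in OY_pred P x -> germ P x f = f :> K.
Proof. by move=> fO; rewrite /germ /insubd (insubT (mem (OY_pred P x)) fO). Qed.

Definition OYincl : {rmorphism OYx -> K} := (\val : OYx -> K).

Definition extends (D : K -> K) (l : OmegaY P x -> K) : Prop :=
  linear_over OYincl l /\ forall a, l (d a) = D (OYval a).

Lemma extends_exists D : derivation (@cst k) D -> exists l, extends D l.
Proof.
move=> DD; apply: (@kaehler_universal _ _ _ _ OYincl (fun a => D (OYval a))).
- by move=> a b; rewrite -(derD DD).
- by move=> a b; rewrite -(derM DD).
- by move=> c; rewrite -[RHS](derC DD c).
Qed.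

Lemma extends_torsion D l m : extends D l -> m \in torsion (OmegaY P x) ->
  l m = 0.
Proof.
move=> [lP _] /asboolP [r [rreg rm]]; have := linear_overZ lP r m.
rewrite rm (linear_over0 lP) => /esym/eqP;
  rewrite mulf_eq0 => /orP [/eqP r0|/eqP //].
have r00 : r = 0 by apply: val_inj; rewrite rmorph0.
by have := rreg 1 0; rewrite r00 !mul0r => /(_ erefl) /eqP; rewrite oner_eq0.
Qed.

Lemma extends_sum D l (ab : seq (K * K)) : extends D l ->
  (forall z, z \in ab -> z.1 \in OY_pred P x /\ z.2 \in OY_pred P x) ->
  l (\sum_(z <- ab) germ P x z.1 *: d (germ P x z.2)) =
  \sum_(z <- ab) z.1 * D z.2.
Proof.
move=> [lP ld] h; rewrite (linear_over_sum lP); apply: eq_big_seq => z zab.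
have [h1 h2] := h z zab; rewrite (linear_overZ lP) ld germK //.
by congr (_ * _); exact: germK.
Qed.

End Stalk.

Section Criterion.
Variables (n : nat) (W : point k -> Prop) (X Y : K) (dX dY : K -> K).
Variables (b : 'I_n -> K) (D : 'I_n -> K -> K).
Hypothesis XY : coordinates (@cst k) X Y dX dY.
Hypothesis Wopen : openX W.
Hypothesis Dder : forall i, derivation (@cst k) (D i).
Hypothesis Db : forall i j, D i (b j) = (i == j)%:R.
Hypothesis expandX : forall f, dX f = \sum_(i < n) D i f * dX (b i).
Hypothesis expandY : forall f, dY f = \sum_(i < n) D i f * dY (b i).
Hypothesis bO : forall x, W x -> forall i, b i \in OY_pred P x.
Hypothesis DO : forall x, W x ->
  forall i f, f \in OY_pred P x -> D i f \in OY_pred P x.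
Hypothesis conductor : forall x, W x -> exists c, [/\ c != 0,
  c \in OY_pred P x, c * X \in OY_pred P x & c * Y \in OY_pred P x].

Let e i x : OmegaY_mod_tors P x :=
  mproj (torsion (OmegaY P x)) (kaehler_d (@OY_cst k P x) (germ P x (b i))).

(** The conductor hypothesis puts numerators and a common denominator of X
    and Y in the local ring, as kaehler_torsionP requires. *)
Lemma torsion_extends x lX lY (m : OmegaY P x) : W x ->
  extends dX lX -> extends dY lY -> lX m = 0 -> lY m = 0 ->
  m \in torsion (OmegaY P x).
Proof.
move=> Wx [lXP lXd] [lYP lYd]; have [c [c0 cO cX cY]] := conductor Wx.
have gc0 : germ P x c != 0.
  by apply: contra_neq c0 => g0; rewrite -(germK cO) g0.
have inj : injective (OYincl x) by exact: val_inj.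
apply: (@kaehler_torsionP _ _ (@OY_cst k P x) _ (OYincl x) X Y dX dY inj XY
  (germ P x c) (germ P x (c * X)) (germ P x (c * Y)) gc0 _ _ lX lY) => //.
- by rewrite [LHS](germK cX) [OYincl x _](germK cO).
- by rewrite [LHS](germK cY) [OYincl x _](germK cO).
Qed.

Lemma basis_sections i : sectionOmega_mod_tors W (e i).
Proof.
move=> x Wx; exists W; split; first by split.
exists (fun y => kaehler_d (@OY_cst k P y) (germ P y (b i))); split => //.
move=> y Wy; exists W; split; first by split.
exists [:: (1, b i)]; split.
  move=> z; rewrite inE => /eqP -> /=; split=> t Wt; last exact: bO.
  exact: (subring_1 (OY_subring P t)).
move=> t Wt; rewrite big_seq1 /=.
have -> : germ P t 1 = 1.
  by apply: val_inj; rewrite [LHS]germK //; apply: (subring_1 (OY_subring P t)).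
by rewrite scale1r.
Qed.

(** A section is given near x by one sum of differentials, and this
    neighbourhood of x contains the generic point. *)
Lemma section_comb W' s x : sectionOmega_mod_tors W' s -> openX W' -> W' x ->
  exists ab : seq (K * K),
  (forall z, z \in ab ->
     (z.1 \in OY_pred P x /\ z.2 \in OY_pred P x) /\
     (z.1 \in OY_pred P (generic_point k) /\
      z.2 \in OY_pred P (generic_point k))) /\
  forall y, y = x \/ y = generic_point k -> s y = mproj (torsion (OmegaY P y))
    (\sum_(z <- ab) germ P y z.1 *: kaehler_d (@OY_cst k P y) (germ P y z.2)).
Proof.
move=> sW W'o W'x; have [W1 [[W1o W1x _] [m [mW ms]]]] := sW x W'x.
have [W2 [[W2o W2x W21] [ab [abO mE]]]] := mW x W1x.
have W2g : W2 (generic_point k) by apply: generic_in_open => //; exists x.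
exists ab; split.
  by move=> z /abO [h1 h2]; split; split; auto.
by move=> y [->|->]; rewrite ms ?mE //; apply: W21.
Qed.

(** The coefficient of db_i in a section is its image under D i. This image
    is an element of k(u, v) which does not depend on the point
    (section_comb), and it lies in each local ring because D i preserves
    them. *)
Lemma free_on_criterion : free_on n (@sectionOmega_mod_tors k P) W.
Proof.
exists e; split; first exact: basis_sections.
move=> W' W'o W'W [x0 W'x0] s sW; pose g := generic_point k.
have W'g : W' g by apply: generic_in_open => //; exists x0.
have [ab0 [ab0O s0]] := section_comb sW W'o W'g.
have sg := s0 g (or_introl erefl).
pose a : {ffun 'I_n -> K} := [ffun i => \sum_(z <- ab0) z.1 * D i z.2].
have coef y : W' y -> exists ab : seq (K * K),
  [/\ forall z, z \in ab -> z.1 \in OY_pred P y /\ z.2 \in OY_pred P y,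
      s y = mproj (torsion (OmegaY P y))
       (\sum_(z <- ab) germ P y z.1 *: kaehler_d (@OY_cst k P y) (germ P y z.2))
         &
      forall i, a i = \sum_(z <- ab) z.1 * D i z.2].
  move=> W'y; have [ab [abO sE]] := section_comb sW W'o W'y.
  exists ab; split; first by move=> z /abO [].
    by apply: sE; left.
  move=> i; rewrite ffunE; have [l lD] := extends_exists g (Dder i).
  have := sE g (or_intror erefl); rewrite sg => /mproj_eq /(extends_torsion lD).
  rewrite (linear_overB lD.1) !(extends_sum lD).
  - by move/eqP; rewrite subr_eq0 => /eqP.
  - by move=> z /abO [].
  - by move=> z /ab0O [].
have aO i y : W' y -> a i \in OY_pred P y.
  move=> W'y; have [ab [abO _ ->]] := coef y W'y.
  have Os := OY_subring P y; rewrite big_seq.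
  apply: (big_ind (fun f => f \in OY_pred P y)).
  - exact: (subring_0 Os).
  - by move=> f1 f2; apply: (subring_D Os).
  - move=> z /abO [h1 h2]; apply: (subring_M Os) => //.
    by apply: DO => //; apply: W'W.
have combE (c : 'I_n -> K) y : W' y -> (forall i, c i \in OY_pred P y) ->
    \sum_(i < n) germ P y (c i) *: e i y = mproj (torsion (OmegaY P y))
     (\sum_(z <- [seq (c i, b i) | i <- enum 'I_n])
        germ P y z.1 *: kaehler_d (@OY_cst k P y) (germ P y z.2)).
  move=> W'y cO; rewrite big_map raddf_sum big_enum /=.
  by apply: eq_bigr => i _; rewrite [RHS]linearZ.
have combO (c : 'I_n -> K) y : W' y -> (forall i, c i \in OY_pred P y) ->
    forall z, z \in [seq (c i, b i) | i <- enum 'I_n] ->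
    z.1 \in OY_pred P y /\ z.2 \in OY_pred P y.
  by move=> W'y cO z /mapP [i _ ->]; split => //=; apply: bO; apply: W'W.
exists a; split.
  split=> [i y W'y|y W'y]; first exact: aO.
  have [ab [abO -> aE]] := coef y W'y; have Wy := W'W _ W'y.
  rewrite combE //; last by move=> i; apply: aO.
  apply/mproj_eq; have [lX lXD] := extends_exists y (dx_der XY).
  have [lY lYD] := extends_exists y (dy_der XY).
  have aO' := combO a y W'y (fun i => aO i y W'y).
  apply: (torsion_extends Wy lXD lYD).
    rewrite (linear_overB lXD.1) !(extends_sum lXD) // big_map big_enum /=.
    apply/eqP; rewrite subr_eq0; apply/eqP.
    under eq_bigr => z _ do rewrite expandX mulr_sumr.
    rewrite exchange_big; apply: eq_bigr => i _ /=; rewrite aE mulr_suml.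
    by apply: eq_bigr => z _; rewrite mulrA.
  rewrite (linear_overB lYD.1) !(extends_sum lYD) // big_map big_enum /=.
  apply/eqP; rewrite subr_eq0; apply/eqP.
  under eq_bigr => z _ do rewrite expandY mulr_sumr.
  rewrite exchange_big; apply: eq_bigr => i _ /=; rewrite aE mulr_suml.
  by apply: eq_bigr => z _; rewrite mulrA.
move=> a' [a'O a'E]; apply/ffunP => j.
have [ab [abO sE aE]] := coef x0 W'x0.
have [l lD] := extends_exists x0 (Dder j).
have a'O' := combO a' x0 W'x0 (fun i => a'O i x0 W'x0).
have := a'E x0 W'x0; rewrite combE //; last by move=> i; apply: a'O.
rewrite sE => /mproj_eq /(extends_torsion lD).
rewrite (linear_overB lD.1) !(extends_sum lD) // -aE => /eqP.
rewrite subr_eq0 => /eqP ->;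
  rewrite big_map big_enum /= (bigD1 j) //= Db eqxx mulr1.
rewrite big1 ?addr0 // => i ij; rewrite Db eq_sym (negbTE ij) mulr0 //.
Qed.
End Criterion.
End FreeCriterion.

(** * The open cover *)

Section FreePair.
Variables (k : fieldType) (P : {poly_4 k}).
Local Notation K := (K k).
Variables (W : point k -> Prop) (X Y : K) (dX dY : K -> K).
Variables (b1 b2 : K) (D1 D2 : K -> K).

Lemma free_on_pair : coordinates (@cst k) X Y dX dY -> openX W ->
  derivation (@cst k) D1 /\ derivation (@cst k) D2 ->
  [/\ D1 b1 = 1, D2 b1 = 0, D1 b2 = 0 & D2 b2 = 1] ->
  (forall f, dX f = D1 f * dX b1 + D2 f * dX b2 /\
             dY f = D1 f * dY b1 + D2 f * dY b2) ->
  (forall x, W x -> b1 \in OY_pred P x /\ b2 \in OY_pred P x) ->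
  (forall x, W x -> forall f, f \in OY_pred P x ->
     D1 f \in OY_pred P x /\ D2 f \in OY_pred P x) ->
  (forall x, W x -> exists c, [/\ c != 0,
     c \in OY_pred P x, c * X \in OY_pred P x & c * Y \in OY_pred P x]) ->
  free_on 2 (@sectionOmega_mod_tors k P) W.
Proof.
move=> XY Wo [der1 der2] [D1b1 D2b1 D1b2 D2b2] ex bO DO cond.
pose b (i : 'I_2) := if i == ord0 then b1 else b2.
pose D (i : 'I_2) := if i == ord0 then D1 else D2.
have I2 (Q : 'I_2 -> Prop) : Q ord0 -> Q (fintype.lift ord0 ord0) ->
  forall i, Q i.
  by move=> Q0 Q1 i; case: (unliftP ord0 i) => [j|] -> //; rewrite (ord1 j).
apply: (@free_on_criterion k P 2 W X Y dX dY b D) => //.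
- by apply: (I2).
- by apply: (I2); apply: (I2).
- by move=> f; rewrite !big_ord_recl big_ord0 addr0; case: (ex f).
- by move=> f; rewrite !big_ord_recl big_ord0 addr0; case: (ex f).
- by move=> x /bO [h1 h2]; apply: I2.
- by move=> x Wx i f fO; have [h1 h2] := DO x Wx f fO; move: i; apply: I2.
Qed.
End FreePair.

Lemma regular_locus2 (k : fieldType) (a b : K k) x :
  regular_locus [:: a; b] x <-> a \in OX x /\ b \in OX x.
Proof.
split=> [h|[ha hb] f]; first by split; apply: h; rewrite !inE eqxx ?orbT.
by rewrite !inE => /orP [] /eqP ->.
Qed.

Lemma regular_locus3 (k : fieldType) (a b c : K k) x :
  regular_locus [:: a; b; c] x <-> [/\ a \in OX x, b \in OX x & c \in OX x].
Proof.
split=> [h|[ha hb hc] f]; first by split; apply: h; rewrite !inE eqxx ?orbT.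
by rewrite !inE => /or3P [] /eqP ->.
Qed.

Section Cover.
Variables (k : fieldType) (P : {poly_4 k}).
Hypothesis kchar2 : forall a : k, a + a = 0.
Local Notation K := (K k).
Local Notation u := (@u k).
Local Notation v := (@v k).
Local Notation Pp := (P : {poly k}).
Local Notation Pu := (evalu Pp).
Local Notation s := (chx k chU').
Local Notation r := (chy k chU').
Local Notation R := (revPu P).
Local Notation J := (1 + r * chdx chU' R).

Let Kchar2 := K_char2 kchar2.
Let u0 := u_neq0 k.
Let v0 := v_neq0 k.
Let r0 : r != 0.
Proof. by rewrite mulf_neq0 ?invr_eq0; [|exact: v0|exact: u0]. Qed.

Lemma free_off_line : free_on 2 (@sectionOmega_mod_tors k P)
  (regular_locus [:: chx k chU''; chy k chU'']).
Proof.
have xy := chart_coordinates k chU''.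
have Wc x : regular_locus [:: chx k chU''; chy k chU''] x -> in_chart x chU''.
  by move/regular_locus2.
apply: (free_on_pair xy (D1 := chdx chU'') (D2 := chdy chU'')
  (b1 := chx k chU'') (b2 := chy k chU'')).
- exact: regular_locus_open.
- by split; [exact: dx_der xy | exact: dy_der xy].
- by rewrite (dx_x xy) (dx_y xy) (dy_x xy) (dy_y xy).
- by move=> f; rewrite (dx_x xy) (dx_y xy) (dy_x xy) (dy_y xy) !mulr1 !mulr0
  addr0 add0r.
- by move=> x /Wc xc; have [Ox Oy] := xc; split; apply/(OY_in_U'' P _ xc).
- move=> x /Wc xc f /(OY_in_U'' P _ xc) fO.
  by split; apply/(OY_in_U'' P _ xc); [apply: chdxO | apply: chdyO].
- move=> x /Wc xc; have [Ox Oy] := xc; exists 1; rewrite !mul1r oner_neq0.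
  split => //; apply/(OY_in_U'' P _ xc) => //;
    exact: (subring_1 (OX_subring x)).
Qed.

Lemma free_along_smooth : J != 0 -> free_on 2 (@sectionOmega_mod_tors k P)
  (regular_locus [:: s; r; J^-1]).
Proof.
move=> J0; have xy := chart_coordinates k chU'.
have dyR := chdy_revPu P.
have Wc x : regular_locus [:: s; r; J^-1] x -> in_chart x chU' /\ J^-1 \in OX x.
  by move=> /regular_locus3 [Ox Oy OJ].
have ideal x t : in_chart x chU' -> t \in OX x -> r ^+ 2 * t \in OY_pred P x.
  move=> xc tO; apply/(OY_in_U' P kchar2 _ xc); have [Ox Oy] := xc.
  apply: (glued_smooth_ideal Kchar2 xy (OX_subring x) (chdxO xc)
    (chdyO xc)) => //.
  exact: (chart_sub xc (revPu_chart P)).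
apply: (free_on_pair xy (b1 := s + r * R) (b2 := r ^+ 3)
   (D1 := smooth1 r (chdx chU') R) (D2 := smooth2 r (chdx chU') (chdy chU') R)).
- exact: regular_locus_open.
- exact: (smooth_derivation xy r0 J0).
- exact: (smooth_basis Kchar2 xy r0 dyR J0).
- exact: (smooth_expand Kchar2 xy r0 dyR J0).
- move=> x /Wc [xc OJ]; have [Ox Oy] := xc; have Os := OX_subring x.
  have OR := chart_sub xc (revPu_chart P).
  split; last by rewrite (exprSr r 2); exact: (ideal x r xc Oy).
  apply/(OY_in_U' P kchar2 _ xc).
  exact: (glued_smooth_par xy Os (chdxO xc) Ox Oy OR dyR).
- move=> x /Wc [xc OJ] f /(OY_in_U' P kchar2 _ xc) fS; have Os := OX_subring x.
  have OR := chart_sub xc (revPu_chart P).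
  have [h1 h2] := glued_smooth_dual Kchar2 xy Os (chdxO xc) (chdyO xc) r0 OR dyR
    J0 OJ fS.
  by split; apply/(OY_in_U' P kchar2 _ xc).
- move=> x /Wc [xc OJ]; have [Ox Oy] := xc; exists (r ^+ 2).
  split; [exact: (expf_neq0 2 r0) | | exact: (ideal x s xc Ox)
    | exact: (ideal x r xc Oy)].
  by rewrite -[r ^+ 2]mulr1; exact: (ideal x 1 xc (subring_1 (OX_subring x))).
Qed.

Lemma free_at_cusp : Pu != 0 -> free_on 2 (@sectionOmega_mod_tors k P)
  (regular_locus [:: u; v; Pu^-1]).
Proof.
move=> P0; have xy := chart_coordinates k chU; have dvP := dv_Pu P.
have Wc x : regular_locus [:: u; v; Pu^-1] x -> in_chart x chU /\
  unit_in (OX x) Pu.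
  by move=> /regular_locus3 [Ox Oy OPV]; rewrite /unit_in P0.
have ideal x t : in_chart x chU -> unit_in (OX x) Pu -> t \in OX x ->
    v ^+ 2 * t \in OY_pred P x.
  move=> xc uP tO; apply/(OY_in_U kchar2 _ xc uP); have [Ox Oy] := xc.
  exact: (glued_cusp_ideal Kchar2 xy (OX_subring x) (chdxO xc) (chdyO xc) Ox Oy
           (unit_in_inv uP) P0 tO).
apply: (free_on_pair xy (b1 := u ^+ 3 + v * Pu) (b2 := v ^+ 2 * u)
   (D1 := cusp1 (@dv k) Pu) (D2 := cusp2 u v (@du k) (@dv k) Pu)).
- exact: regular_locus_open.
- exact: (cusp_derivation xy v0 P0).
- exact: (cusp_basis Kchar2 xy v0 P0 dvP).
- exact: (cusp_expand Kchar2 xy v0 P0 dvP).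
- move=> x /Wc [xc uP]; have [Ox Oy] := xc.
  split; last exact: (ideal x u xc uP Ox).
  apply/(OY_in_U kchar2 _ xc uP).
  exact: (glued_cusp_z Kchar2 xy (OX_subring x) (chdxO xc) Ox Oy (Pu_in P xc)
    P0 dvP).
- move=> x /Wc [xc uP] f /(OY_in_U kchar2 _ xc uP) fS.
  have [h1 h2] := glued_cusp_dual Kchar2 xy (OX_subring x) (chdxO xc) (chdyO xc)
    v0 (Pu_in P xc) (unit_in_inv uP) P0 dvP fS.
  by split; apply/(OY_in_U kchar2 _ xc uP).
- move=> x /Wc [xc uP]; have [Ox Oy] := xc; exists (v ^+ 2).
  split; [exact: (expf_neq0 2 v0) | | exact: (ideal x u xc uP Ox)
    | exact: (ideal x v xc uP Oy)].
  by rewrite -[v ^+ 2]mulr1;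
    exact: (ideal x 1 xc uP (subring_1 (OX_subring x))).
Qed.

(** J = 1 on A. *)
Lemma unit_J x : in_chart x chU' -> ~~ unit_in (OX x) r -> unit_in (OX x) J.
Proof.
move=> xc; have [_ Or] := xc; have Os := OX_subring x; apply: contraR => uJ.
have OR' := chdxO xc (chart_sub xc (revPu_chart P)).
have OrR : r * chdx chU' R \in OX x by apply: (subring_M Os).
have OJ : J \in OX x by apply: (subring_D Os (subring_1 Os)).
have := @OX_nonunitD _ x J (- (r * chdx chU' R)) OJ (subring_N Os OrR).
rewrite addrK => /(_ (unit_in1 Os)); rewrite (negbTE uJ) /= -mulrN mulrC.
by apply: (unit_in_mulr Os); apply: (subring_N Os).
Qed.

(** P takes the value alpha_0 at u = 0. *)
Lemma unit_P x : Pp`_0 != 0 -> in_chart x chU -> ~~ unit_in (OX x) u ->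
  unit_in (OX x) Pu.
Proof.
move=> a0 xc nu; have [Ou _] := xc; have Os := OX_subring x.
have [e eO PE] : exists2 e, e \in OX x & Pu = cst Pp`_0 + u * e.
  have AO := chart_sub xc; rewrite evaluE; elim/poly_ind: Pp => [|q c _].
    exists 0; first exact: (subring_0 Os).
    by rewrite peval0 coef0 rmorph0 mulr0 addr0.
  exists (peval (@cst k) u q).
    apply: AO; apply: (peval_in _ (OX_chart_subring k chU));
      last exact: (chx_chart k chU).
    by move=> a; apply: cst_chart.
  rewrite pevalD pevalM pevalX pevalC coefD coefMX coefC eqxx add0r.
  by rewrite addrC mulrC.
have c0 : unit_in (OX x) (cst Pp`_0).
  rewrite /unit_in fmorph_eq0 a0 -fmorphV /=.
  exact: (chart_sub xc (cst_chart chU _)).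
have := @OX_nonunitD _ x Pu (- (u * e)) (Pu_in P xc)
  (subring_N Os (subring_M Os Ou eO)).
rewrite {1}PE addrK => /(_ c0) /orP [//|]; rewrite -mulrN mulrC.
by move=> /(unit_in_mulr Os (subring_N Os eO)) h; rewrite h in nu.
Qed.

End Cover.

Theorem theorem6p1 (k : fieldType) (P : {poly_4 k})
    (char2 : 2%N \in [pchar k]) (alpha0 : (P : {poly k})`_0 != 0) :
  locally_free 2 (@sectionOmega_mod_tors k P).
Proof.
have kchar2 (a : k) : a + a = 0 by apply: addrr_pchar2.
have u0 := u_neq0 k; have v0 := v_neq0 k.
have locus x l : regular_locus l x ->
  free_on 2 (@sectionOmega_mod_tors k P) (regular_locus l) ->
  exists W, [/\ openX W, W x & free_on 2 (@sectionOmega_mod_tors k P) W].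
  by move=> Wx fW; exists (regular_locus l); split => //;
    exact: regular_locus_open.
have off x : in_chart x chU'' ->
  exists W, [/\ openX W, W x & free_on 2 (@sectionOmega_mod_tors k P) W].
  by move=> xc; apply: (locus _ _ _ (free_off_line P)); apply/regular_locus2.
have smooth x : in_chart x chU' ->
  exists W, [/\ openX W, W x & free_on 2 (@sectionOmega_mod_tors k P) W].
  move=> xc; have [Ox Oy] := xc; have Os := OX_subring x.
  have [ry|rn] := boolP (unit_in (OX x) (chy k chU')).
    apply: off; have := unit_in_inv ry; rewrite /= invfM invrK => ryV.
    have uvO : u * v^-1 \in OX x by rewrite mulrC.
    split => //=; rewrite -[v^-1](mulKf u0); exact: (subring_M Os).
  have uJ := unit_J P xc rn.
  apply: (locus _ _ _ (free_along_smooth kchar2 (unit_in_neq0 uJ))).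
  by apply/regular_locus3; split=> //; exact: unit_in_inv uJ.
move=> x; have [c [p xp]] := pointP x; have := at_in_chart xp;
  case: c {p xp} => xc.
- have [Ox Oy] := xc; have Os := OX_subring x.
  have [vU|vn] := boolP (unit_in (OX x) v).
    have vV := unit_in_inv vU; apply: off; split => //; exact: (subring_M Os).
  have [uU|un] := boolP (unit_in (OX x) u).
    have uV := unit_in_inv uU; apply: smooth; split => //;
      exact: (subring_M Os).
  have uP := unit_P alpha0 xc un.
  apply: (locus _ _ _ (free_at_cusp kchar2 (unit_in_neq0 uP))).
  by apply/regular_locus3; split=> //; exact: unit_in_inv uP.
- exact: smooth.
- exact: off.
Qed.
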